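(* Let $V\subset\mathbb{C}^4$ be a generic complex affine plane, $V^\times=V\cap(\mathbb{C}^\times)^4$, let $\mathcal{B}:V^\times\to(\mathbb{R}P^1)^4$ be its rolled coamoeba map, $Z\subset V^\times$ the set of critical points of $\mathcal{B}$, and $\mathcal{B}_Z=\mathcal{B}(Z)$ the set of critical values. Then there is a compactification $\hat{Z}$ of $Z$ which is the total space of a locally trivial circle bundle $\hat{Z}\to\mathcal{B}_Z$ whose projection map is an extension of $\mathcal{B}|_Z:Z\to\mathcal{B}_Z$. Moreover, there are five distinguished sections of $\hat{Z}\to\mathcal{B}_Z$ such that $Z$ is the result of removing (the images of) these five sections from $\hat{Z}$.
   Context: Notation: $\mathbb{C}^\times=\mathbb{C}\setminus\{0\}$. A complex affine plane in $\mathbb{C}^4$ is a complex affine subspace of complex dimension 2. ''Generic'' means: outside a proper real-algebraic subset of the space of all complex affine planes in $\mathbb{C}^4$. The map $2Arg:(\mathbb{C}^\times)^4\to(\mathbb{R}P^1)^4$ is defined coordinatewise by $2arg(z)=[\mathrm{Re}(z):\mathrm{Im}(z)]\in\mathbb{R}P^1$; equivalently, $2arg(z)$ is the real line in $\mathbb{C}$ through $0$ and $z$. The rolled coamoeba map $\mathcal{B}$ is the restriction of $2Arg$ to $V^\times$. It is a smooth map between real 4-dimensional manifolds; its critical points are the points where its real differential is not surjective. (The set $Z$ is also the critical locus of the restrictions to $V^\times$ of the coordinatewise maps $Log:z\mapsto\log|z|$ and $Arg:z\mapsto z/|z|$.) $Z$ and $\mathcal{B}_Z$ carry the subspace topologies.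 *)

(* Defs.v *)
From HB Require Import structures.
From mathcomp Require Import all_boot all_order all_algebra.
From mathcomp Require Import all_classical all_reals all_analysis.
From mathcomp Require Import complex.
From mathcomp Require mpoly.

Set Implicit Arguments.
Unset Strict Implicit.
Unset Printing Implicit Defensive.

Import Order.TTheory GRing.Theory Num.Theory.
Import numFieldNormedType.Exports.
Local Open Scope classical_set_scope.
Local Open Scope ring_scope.
Local Open Scope quotient_scope.

(* Typed as a numFieldType so that R[i], and row vectors over it, receive the
   topology of the modulus. *)
Definition Cplx (R : realType) : numFieldType := R[i].

(** The real projective line, as the quotient of R^2 minus the origin *)

Definition punctured_plane (R : realType) : set (R * R) := [set v | v != 0].

Definition same_line (R : realType) (v w : set_type (@punctured_plane R)) : bool :=
  `[< exists2 t : R, t != 0 & val w = (t * (val v).1, t * (val v).2) >].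

Lemma same_line_equiv (R : realType) : equiv_class_of (@same_line R).
Proof.
split=> [v|v w|w v x].
- by apply/asboolP; exists 1; rewrite ?oner_eq0// !mul1r -surjective_pairing.
- apply/asboolP/asboolP => -[t t0 ->]; exists t^-1; rewrite ?invr_eq0//=;
    by rewrite !mulKf// -surjective_pairing.
- move=> /asboolP[t t0 vE] /asboolP[s s0 xE]; apply/asboolP.
  by exists (s * t); rewrite ?mulf_neq0// xE vE /= !mulrA.
Qed.

Canonical same_line_equiv_rel (R : realType) :=
  EquivRelPack (@same_line_equiv R).

Definition RP1 (R : realType) : topologicalType :=
  quotient_topology {eq_quot (same_line_equiv_rel R)}.

Lemma punctured_plane10 (R : realType) :
  ((1, 0) : R * R) \in @punctured_plane R.
Proof. by apply/mem_set/eqP => -[/eqP]; rewrite oner_eq0. Qed.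

(* [hcoord x y] is [x : y]; the value at the excluded pair (0, 0) is junk. *)
Definition hcoord (R : realType) (x y : R) : RP1 R :=
  \pi_(quotient_topology {eq_quot (same_line_equiv_rel R)})
    (insubd (exist _ (1, 0) (punctured_plane10 R)) (x, y)
       : set_type (@punctured_plane R)).

(* The two standard affine charts, [x : y] |-> y / x where x != 0 and
   [x : y] |-> x / y where y != 0; neither the domains nor the values depend on
   the representative (x, y). *)
Definition hrepr (R : realType) (l : RP1 R) : R * R :=
  val (repr (l : quotient_topology {eq_quot (same_line_equiv_rel R)})).

Definition chart_dom (R : realType) (c : bool) : set (RP1 R) :=
  [set l | (if c then (hrepr l).2 else (hrepr l).1) != 0].

Definition chart (R : realType) (c : bool) (l : RP1 R) : R :=
  if c then (hrepr l).1 / (hrepr l).2 else (hrepr l).2 / (hrepr l).1.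

(** Rolled coamoebas of affine planes *)

Definition RP1_4 (R : realType) : topologicalType := {ptws 'I_4 -> RP1 R}.

Definition two_arg (R : realType) (z : Cplx R) : RP1 R :=
  hcoord (complex.Re z) (complex.Im z).

(* Meaningful on (C \ 0)^4 only, since [two_arg 0] is junk. *)
Definition TwoArg (R : realType) (z : 'rV[Cplx R]_4) : RP1_4 R :=
  fun j => two_arg (z 0 j).

Definition aff (R : realType) (p : 'rV[Cplx R]_4) (M : 'M[Cplx R]_(2, 4))
    (w : 'rV[Cplx R]_2) : 'rV[Cplx R]_4 := p + w *m M.

Definition affine_frame (R : realType) (V : set 'rV[Cplx R]_4)
    (p : 'rV[Cplx R]_4) (M : 'M[Cplx R]_(2, 4)) : Prop :=
  row_free M /\ V = range (aff p M).

Definition affine_plane (R : realType) (V : set 'rV[Cplx R]_4) : Prop :=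
  exists p M, affine_frame V p M.

Definition torus_part (R : realType) (V : set 'rV[Cplx R]_4) :
  set 'rV[Cplx R]_4 := [set z | V z /\ forall j, z 0 j != 0].

Definition rolled_coamoeba (R : realType) (V : set 'rV[Cplx R]_4)
    (z : set_type (torus_part V)) : RP1_4 R := TwoArg (set_val z).

Definition complexify (R : realType) (u : 'rV[R]_(2 + 2)) : 'rV[Cplx R]_2 :=
  \row_k Complex (lsubmx u 0 k) (rsubmx u 0 k).

(* The rolled coamoeba map, read in the real coordinates of V given by an
   affine frame and in a product of standard charts of (RP^1)^4. *)
Definition coord_expr (R : realType) (p : 'rV[Cplx R]_4)
    (M : 'M[Cplx R]_(2, 4)) (c : 'I_4 -> bool) (u : 'rV[R]_(2 + 2)) : 'rV[R]_4 :=
  \row_j chart (c j) (TwoArg (aff p M (complexify u)) j).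

(* The rank of the differential does not depend on the coordinates used. *)
Definition critical_points (R : realType) (V : set 'rV[Cplx R]_4) :
    set (set_type (torus_part V)) :=
  [set z | exists p M u c,
    [/\ affine_frame V p M, set_val z = aff p M (complexify u),
        forall j, chart_dom (c j) (rolled_coamoeba z j) &
        range ('d (coord_expr p M c) u) <> setT]].

Definition critical_values (R : realType) (V : set 'rV[Cplx R]_4) :
  set (RP1_4 R) := @rolled_coamoeba R V @` @critical_points R V.

(** Genericity *)

Definition frame_coords (R : realType) (p : 'rV[Cplx R]_4)
    (M : 'M[Cplx R]_(2, 4)) : 'rV[R]_((1 + 2 + (1 + 2)) * 4) :=
  mxvec (col_mx (map_mx (@complex.Re R) (col_mx p M))
                (map_mx (@complex.Im R) (col_mx p M))).

(* The space of affine planes is the quotient of the space of affine frames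
   (p, M) by the group of affine automorphisms of C^2, and the quotient map has
   regular local sections. Hence a set of planes is real-algebraic iff the
   frames of its members are cut out, among all frames, by real polynomial
   equations in the real and imaginary parts of the entries of p and M. *)
Definition real_algebraic (R : realType) (E : set (set 'rV[Cplx R]_4)) : Prop :=
  E `<=` @affine_plane R /\
  exists S : set (mpoly.mpoly ((1 + 2 + (1 + 2)) * 4) R),
    forall V p M, affine_frame V p M ->
      (E V <-> forall f, S f -> mpoly.meval (frame_coords p M 0) f = 0).

Definition for_generic_plane (R : realType)
    (P : set 'rV[Cplx R]_4 -> Prop) : Prop :=
  exists E, [/\ real_algebraic E, E <> @affine_plane R &
    forall V, affine_plane V -> ~ E V -> P V].

(** Compactifications and circle bundles *)

Definition homeomorphism (X Y : topologicalType) (f : X -> Y) : Prop :=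
  continuous f /\ exists g, [/\ continuous g, cancel f g & cancel g f].

Definition embedding (X Y : topologicalType) (f : X -> Y) : Prop :=
  injective f /\
  forall A, open A <-> exists2 B : set Y, open B & f @^-1` B = A.

Definition compactification (X Y : topologicalType) (f : X -> Y) : Prop :=
  [/\ compact [set: Y], hausdorff_space Y, embedding f & dense (range f)].

Definition circle (R : realType) : set (R * R) :=
  [set v | v.1 ^+ 2 + v.2 ^+ 2 = 1].

Definition circle_bundle (R : realType) (X B : topologicalType)
    (p : X -> B) : Prop :=
  continuous p /\
  forall b, exists U : set B, [/\ open U, U b &
    exists phi : set_type (p @^-1` U) ->
                 (set_type U * set_type (@circle R))%type,
      homeomorphism phi /\ forall x, set_val (phi x).1 = p (set_val x)].

Definition cont_section (X B : topologicalType) (p : X -> B) (s : B -> X) : Prop :=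
  continuous s /\ cancel s p.

(* Main.v *)
Require Import Defs.
From HB Require Import structures.
From mathcomp Require Import all_boot all_order all_algebra.
From mathcomp Require Import all_classical all_reals all_analysis.
From mathcomp Require Import complex.
From mathcomp Require mpoly.
From mathcomp Require Import ring lra.

(** Fix a frame of V, let z_1, .., z_4 be the coordinates of C^4 restricted to
V and homogenize them. A vector h = (h_0, u) of R x C^2 = R^5 then carries five
numbers F_0(h), .., F_4(h), real-linear in h: F_0(h) = h_0 is real,
F_1(h), .., F_4(h) are complex, and the point of V with parameter u has
coordinates F_j(1, u). For a quadruple b of real lines of C put
  W_b = {h in R^5 : F_j(h) lies on the line b_j for j = 1, .., 4},
a subspace cut out by four real equations. Two points of the torus part have
the same image b exactly when their vectors (1, u) both lie in W_b, and the
kernel of the differential at such a point is the part of W_b where F_0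
vanishes. So a point over b is critical iff dim W_b >= 2, and the critical
points over b are the real lines of W_b on which none of the five F_k vanishes.

Generically dim W_b <= 2, and even W_b meets each ker F_k in at most a line.
The condition required for this is that, for each k, the four complex lines
F_i = 0 (i <> k) of the projective plane cut the line F_k = 0 in four points
whose cross-ratio is not real (generic_frame). Indeed, if u and v are
independent in W_b and F_k(u) = F_k(v) = 0, then F_i(u) and F_i(v) lie on a
common real line for each i, so every minor F_i(u) F_l(v) - F_i(v) F_l(u) is
real up to factors that cancel in the cross-ratio (real_plane_cross_ratio,
generic_frame_fiber). Through minors of the frame the condition becomes the
nonvanishing of one real polynomial, and an example shows that it is not the
zero polynomial (nongeneric_plane_algebraic, nongeneric_plane_proper).

Hence, over a critical value b, the real lines of W_b form a circle, and each
F_k vanishes on exactly one of them. The compactification consists of all pairs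
(b, real line of W_b), the projection is the first component, and the k-th
section sends b to the line of W_b in ker F_k. The section for k = 0 consists
of points at infinity, the other four of points on the closures of the coordinate
hyperplanes.
Real lines of R^5 are encoded by orthogonal projectors.

The compactification is compact as the image of the closed set of all triples
(b, orthonormal pair in W_b) (bundle_space_compact), and the removed sections
have dense complement because on a line through two vectors of W_b each F_k
vanishes at most once (off_divisors_dense). Maps into a compact space with
closed graph are continuous; this gives the continuity of the sections and of
the inverse trivializations. For local triviality, choose a coordinate h_i that
does not vanish on the 0-th section at b: there, and nearby, (h_0, h_i) is an
isomorphism from W_b onto R^2, and doubling angles turns real lines of R^2 into
points of the unit circle (proj_base_circle_bundle).

Finally the sections are pairwise distinct. The complex line joining the point
F_0 = F_c = 0 to the point F_k = F_d = 0 meets the five lines in three points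
only, and three points always lie on a real circle. This provides a critical
value at which sections 0 and c agree, sections k and d agree, and these two
values and the fifth one are distinct (separated_pencil). Two such pairings
tell any two indices apart (sec_injective). *)

Set Implicit Arguments.
Unset Strict Implicit.
Unset Printing Implicit Defensive.
Import Order.TTheory GRing.Theory Num.Theory.
Import numFieldNormedType.Exports.
Local Open Scope classical_set_scope.
Local Open Scope ring_scope.

(** * Continuity and compactness *)

(** For U a neighbourhood of f x, each y outside U has by closedness a
neighbourhood that the graph misses near x; compactness of the complement of U
makes finitely many of them suffice. *)
Lemma closed_graph_continuous (X Y : topologicalType) (f : X -> Y) :
  compact [set: Y] -> closed [set xy : X * Y | xy.2 = f xy.1] -> continuous f.
Proof.
move=> cY cG x A; rewrite nbhsE => -[U [oU Ufx] UA].
have cK : compact (~` U).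
  by apply: (subclosed_compact _ cY) => //; exact: open_closedC.
have /compact_near_coveringP/(_ X (nbhs x) (fun x' y => y <> f x')) := cK.
move=> /(_ _) H.
have : \forall x' \near x, ~` U `<=` (fun y => y <> f x').
  apply: H => y nUy.
  have Gxy : (~` [set xy : X * Y | xy.2 = f xy.1]) (x, y).
    by move=> /= yE; apply: nUy; rewrite yE.
  have := open_nbhs_nbhs (conj (closed_openC cG) Gxy).
  case=> -[V W] /= [Vx Wy] VW; exists (W, V) => //= -[y' x'] [/= Wy' Vx'].
  exact: (VW (x', y') (conj Vx' Wy')).
apply: filterS => x' Ux'; apply: UA; apply: contrapT => nU.
exact: (Ux' (f x')).
Qed.

Lemma continuous_to_sub (X Y : topologicalType) (A : set Y)
  (f : X -> set_type A) : continuous (fun x => set_val (f x)) -> continuous f.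
Proof.
move=> cf; apply/continuousP => _ [U oU <-].
by move/continuousP : cf; apply.
Qed.

Definition sub_elt (T : Type) (A : set T) (x : T) (Ax : A x) : set_type A :=
  exist (fun x => x \in A) x (mem_set Ax).

Lemma set_val_continuous (Y : topologicalType) (A : set Y) :
  continuous (set_val : set_type A -> Y).
Proof. exact: initial_continuous. Qed.

Lemma continuous_at_ptws (X : topologicalType) (I : Type) (Y : topologicalType)
  (f : X -> {ptws I -> Y}) x :
  (forall i, continuous_at x (fun x => f x i)) -> continuous_at x f.
Proof.
move=> cf; apply/cvg_sup => i.
move=> A [_ [[U oU <-] /= Ui UA]].
have := cf i U; move=> /(_ (open_nbhs_nbhs (conj oU Ui))).
by apply: (@filterS _ (nbhs x)) => y /= Uy; exact: UA.
Qed.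

Lemma ptws_proj_continuous (I : eqType) (Y : topologicalType) (i : I) :
  continuous (fun f : {ptws I -> Y} => f i).
Proof.
exact: (@proj_continuous I (fun=> Y) i).
Qed.

Lemma ptws_hausdorff (I : eqType) (Y : topologicalType) :
  hausdorff_space Y -> hausdorff_space {ptws I -> Y}.
Proof. by move=> hY; apply: (@hausdorff_product I (fun=> Y)). Qed.

Lemma injective_continuous_hausdorff (X Y : topologicalType) (f : X -> Y) :
  hausdorff_space Y -> continuous f -> injective f -> hausdorff_space X.
Proof.
move=> hY cf injf p q pq; apply: injf; apply: hY => A B nA nB.
by have [x [Ax Bx]] := pq _ _ (cf _ _ nA) (cf _ _ nB); exists (f x).
Qed.

Section PointwiseContinuity.
Context {K : numFieldType} {T : topologicalType}.
Implicit Types (f g : T -> K) (x : T).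

Lemma continuous_at_ext f g x : continuous_at x f -> f =1 g ->
  continuous_at x g.
Proof. by move=> cf /funext <-. Qed.

Lemma continuous_atD f g x : continuous_at x f -> continuous_at x g ->
  continuous_at x (fun t => f t + g t).
Proof. by move=> cf cg; apply: cvgD. Qed.

Lemma continuous_atB f g x : continuous_at x f -> continuous_at x g ->
  continuous_at x (fun t => f t - g t).
Proof. by move=> cf cg; apply: cvgB. Qed.

Lemma continuous_atM f g x : continuous_at x f -> continuous_at x g ->
  continuous_at x (fun t => f t * g t).
Proof. by move=> cf cg; apply: cvgM. Qed.

Lemma continuous_atX f n x : continuous_at x f ->
  continuous_at x (fun t => f t ^+ n).
Proof.
move=> cf; elim: n => [|n IHn]; first exact: cvg_cst.
apply: (@continuous_at_ext (fun t => f t * f t ^+ n)); first exact: continuous_atM.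
by move=> t; rewrite exprS.
Qed.

Lemma continuous_atV f x : continuous_at x f -> f x != 0 ->
  continuous_at x (fun t => (f t)^-1).
Proof. by move=> cf f0; apply: cvgV. Qed.

Lemma continuous_at_cst (c : K) x : continuous_at x (fun _ : T => c).
Proof. exact: cvg_cst. Qed.

Lemma continuous_at_sum (I : Type) (r : seq I) (P : pred I) (F : I -> T -> K) x :
  (forall i, P i -> continuous_at x (F i)) ->
  continuous_at x (fun t => \sum_(i <- r | P i) F i t).
Proof.
move=> cF; elim: r => [|i r IHr].
  apply: (@continuous_at_ext (fun=> 0)); first exact: cvg_cst.
  by move=> t; rewrite big_nil.
have [Pi|Pi] := boolP (P i).
  apply: (@continuous_at_ext (fun t => F i t + \sum_(j <- r | P j) F j t)).
    by apply: continuous_atD => //; exact: cF.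
  by move=> t; rewrite big_cons Pi.
by apply: continuous_at_ext IHr _ => t; rewrite big_cons (negbTE Pi).
Qed.

Lemma continuous_at_mx m n (F : T -> 'M[K]_(m, n)) x :
  (forall i j, continuous_at x (fun t => F t i j)) ->
  continuous_at x F.
Proof.
move=> cF A [P nP PA].
have : \forall t \near x, forall i, forall j, P i j (F t i j).
  apply: filter_forall => i; apply: filter_forall => j; exact: cF.
by apply: (@filterS _ (nbhs x)) => t Pt; apply: PA.
Qed.

End PointwiseContinuity.

Lemma continuous_entry (K : topologicalType) m n (i : 'I_m) (j : 'I_n) :
  continuous (fun M : 'M[K]_(m, n) => M i j).
Proof.
move=> M A nA; exists (fun k l => if (k == i) && (l == j) then A else setT).
  by move=> k l /=; case: ifP => [/andP[/eqP-> /eqP->]//|_]; exact: filterT.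
by move=> N /= /(_ i j); rewrite !eqxx.
Qed.

Lemma continuous_at_pair (X Y Z : topologicalType) (f : X -> Y) (g : X -> Z) x :
  continuous_at x f -> continuous_at x g ->
  continuous_at x (fun t => (f t, g t)).
Proof. by move=> cf cg; apply: cvg_pair. Qed.

Lemma continuous_fst (Y Z : topologicalType) : continuous (@fst Y Z).
Proof. by move=> x; apply: cvg_fst. Qed.

Lemma continuous_snd (Y Z : topologicalType) : continuous (@snd Y Z).
Proof. by move=> x; apply: cvg_snd. Qed.

Lemma continuous_at_comp (X Y Z : topologicalType) (f : X -> Y) (g : Y -> Z) x :
  continuous_at x f -> continuous_at (f x) g ->
  continuous_at x (fun t => g (f t)).
Proof. by move=> cf cg; apply: continuous_comp. Qed.

Lemma closed_real_eq (T : topologicalType) (R : realType) (f g : T -> R) :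
  continuous f -> continuous g -> closed [set x | f x = g x].
Proof.
move=> cf cg; have cfg : continuous (fun x => f x - g x).
  by move=> x; apply: continuous_atB; [exact: cf|exact: cg].
rewrite (_ : [set x | _] = (fun x => f x - g x) @^-1` [set 0]).
  move/continuous_closedP : cfg; apply; apply: accessible_closed_set1; apply: hausdorff_accessible; exact: Rhausdorff.
by apply/seteqP; split=> x /= => [->|/eqP]; rewrite ?subrr// subr_eq0 => /eqP.
Qed.

Lemma closed_forall (T : topologicalType) (I : Type) (P : I -> set T) :
  (forall i, closed (P i)) -> closed [set x | forall i, P i x].
Proof.
move=> cP; rewrite (_ : [set x | _] = \bigcap_i P i).
  by apply: closed_bigI => i _; exact: cP.
by apply/seteqP; split=> x /= Px i; [move=> _|]; exact: Px.
Qed.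

(** A filter on the subtype is pushed to the ambient space, where it has a
cluster point in A. *)
Lemma compact_set_type (T : topologicalType) (A : set T) :
  compact A -> compact [set: set_type A].
Proof.
move=> cA F PF _.
have FA : (set_val @ F) A.
  by apply: (@filterS _ F _ setT) => //; [move=> x _; exact: set_valP|exact: filterT].
have [x [Ax clx]] := cA _ (fmap_proper_filter set_val PF) FA.
exists (exist _ x (mem_set Ax)); split=> // B C FB.
move=> [_ [[U oU <-] /= Ux UC]].
have [||y [[y' By' <-] Uy]] := clx (set_val @` B) U.
- by apply: (@filterS _ F _ B) => // z Bz; exists z.
- by apply: open_nbhs_nbhs; split=> //; move: Ux; rewrite set_valE.
- by exists y'; split=> //; apply: UC.
Qed.

Lemma set_type_hausdorff (T : topologicalType) (A : set T) :
  hausdorff_space T -> hausdorff_space (set_type A).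
Proof.
move=> hT; apply: (injective_continuous_hausdorff hT (@set_val_continuous T A)).
exact: val_inj.
Qed.

Lemma hausdorff_prod (S T : topologicalType) :
  hausdorff_space S -> hausdorff_space T -> hausdorff_space (S * T)%type.
Proof.
move=> hS hT [p p'] [q q'] clpq; congr (_, _).
  apply: hS => A B nA nB.
  have [[x y] [/= [Ax _] [Bx _]]] := clpq (A `*` setT) (B `*` setT)
    ltac:(by exists (A, setT) => //; split => //; exact: filterT)
    ltac:(by exists (B, setT) => //; split => //; exact: filterT).
  by exists x.
apply: hT => A B nA nB.
have [[x y] [/= [_ Ay] [_ By]]] := clpq (setT `*` A) (setT `*` B)
  ltac:(by exists (setT, A) => //; split => //; exact: filterT)
  ltac:(by exists (setT, B) => //; split => //; exact: filterT).
by exists y.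
Qed.

Lemma closed_equalizer (S T : topologicalType) (f g : S -> T) :
  hausdorff_space T -> continuous f -> continuous g ->
  closed [set x | f x = g x].
Proof.
move=> hT cf cg x clx; apply: hT => A B nA nB.
have [|y [/= e [Ay By]]] := clx (f @^-1` A `&` g @^-1` B).
  by apply: (@filterI _ (nbhs x)); [exact: cf|exact: cg].
by exists (f y); split=> //; rewrite e.
Qed.

(** * The real projective line *)

Section ProjectiveLine.
Local Open Scope quotient_scope.
Variable R : realType.
Implicit Types (b : RP1 R) (x y : R).

Lemma pair_neq0 x y : ((x, y) != 0 :> R * R) = (x != 0) || (y != 0).
Proof.
by rewrite -negb_and.
Qed.

Lemma sqr_norm_gt0 x y : (x, y) != 0 :> R * R -> 0 < x ^+ 2 + y ^+ 2.
Proof.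
rewrite pair_neq0 => /orP[] h.
  by apply: ltr_pwDl; rewrite ?sqr_ge0// exprn_even_gt0.
by apply: ltr_wpDl; rewrite ?sqr_ge0// exprn_even_gt0.
Qed.

Lemma hrepr_neq0 b : hrepr b != 0.
Proof. by have /set_mem := valP (repr (b : quotient_topology {eq_quot (same_line_equiv_rel R)})). Qed.

Lemma hcoord_hrepr b : hcoord (hrepr b).1 (hrepr b).2 = b.
Proof.
rewrite /hcoord -surjective_pairing /hrepr.
by rewrite valKd reprK.
Qed.

Lemma val_insubd_punctured x y : (x, y) != 0 :> R * R ->
  val (insubd (exist _ (1, 0) (punctured_plane10 R)) (x, y)
    : set_type (@punctured_plane R)) = (x, y).
Proof. by move=> h; apply: insubdK; apply/mem_set. Qed.

Lemma hcoord_eq x y x' y' : (x, y) != 0 :> R * R -> (x', y') != 0 :> R * R ->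
  hcoord x y = hcoord x' y' <-> x * y' = x' * y.
Proof.
move=> h h'; split.
  move=> /eqmodP /asboolP [t t0]; rewrite !val_insubd_punctured//=.
  by case=> -> ->; ring.
move=> e; apply/eqmodP/asboolP; rewrite !val_insubd_punctured//=.
move: h; rewrite pair_neq0; have [x0 /= y0|x0 _] := eqVneq x 0.
  move: e; rewrite x0 mul0r => /esym/eqP.
  rewrite mulf_eq0 (negbTE y0) orbF => /eqP x'0.
  exists (y' / y); last by rewrite x'0 mulr0 divfK.
  by move: h'; rewrite x'0 pair_neq0 eqxx /= => y'0; rewrite mulf_neq0 ?invr_eq0.
exists (x' / x); last by rewrite divfK// mulrAC -e mulrAC divff// mul1r.
rewrite mulf_neq0 ?invr_eq0//; apply: contraNneq h' => x'0.
move/eqP : e; rewrite x'0 mul0r mulf_eq0 (negbTE x0) /= => /eqP ->.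
by rewrite eqxx.
Qed.

Lemma hrepr_hcoord x y : (x, y) != 0 :> R * R ->
  (hrepr (hcoord x y)).1 * y = x * (hrepr (hcoord x y)).2.
Proof.
move=> h; apply/hcoord_eq => //; last by rewrite hcoord_hrepr.
by rewrite -surjective_pairing hrepr_neq0.
Qed.

Definition on_line b x y : Prop := x * (hrepr b).2 = y * (hrepr b).1.

Lemma on_lineP b x y : on_line b x y <->
  exists r, x = r * (hrepr b).1 /\ y = r * (hrepr b).2.
Proof.
rewrite /on_line; have := hrepr_neq0 b.
case: (hrepr b) => u v /=; rewrite pair_neq0 => uv; split; last first.
  by case=> r [-> ->]; ring.
move=> e; have [u0|u0] := eqVneq u 0.
  move: uv e; rewrite u0 eqxx /= mulr0 => v0 /eqP; rewrite mulf_eq0 (negbTE v0).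
  by rewrite orbF => /eqP ->; exists (y / v); rewrite mulr0 divfK.
by exists (x / u); rewrite divfK// mulrAC e mulfK.
Qed.

Lemma on_line_lin b x y x' y' s t : on_line b x y -> on_line b x' y' ->
  on_line b (s * x + t * x') (s * y + t * y').
Proof.
by rewrite /on_line => e e'; rewrite !mulrDl -!mulrA e e'.
Qed.

Lemma on_line_collinear b x y x' y' : on_line b x y -> on_line b x' y' ->
  (x, y) != 0 :> R * R -> exists c, x' = c * x /\ y' = c * y.
Proof.
move=> /on_lineP [r [-> ->]] /on_lineP [s [-> ->]] h.
have r0 : r != 0.
  by apply: contraNneq h => ->; rewrite !mul0r.
by exists (s / r); rewrite !mulrA divfK.
Qed.

Lemma on_line_hcoord x y x' y' : (x, y) != 0 :> R * R ->
  on_line (hcoord x y) x' y' <-> x' * y = y' * x.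
Proof.
move=> h; have := hrepr_hcoord h; have := hrepr_neq0 (hcoord x y).
rewrite /on_line; case: (hrepr _) => u v /=; rewrite !pair_neq0 in h * => uv e.
split=> e'.
- case/orP : uv => n0; apply: (mulIf n0).
    have -> : x' * y * u = x' * (u * y) by ring.
    have -> : y' * x * u = x * (y' * u) by ring.
    by rewrite e -e'; ring.
  have -> : x' * y * v = y * (x' * v) by ring.
  have -> : y' * x * v = y' * (x * v) by ring.
  by rewrite e' -e; ring.
- case/orP : h => n0; apply: (mulIf n0).
    have -> : x' * v * x = x' * (x * v) by ring.
    have -> : y' * u * x = u * (y' * x) by ring.
    by rewrite -e -e'; ring.
  have -> : x' * v * y = v * (x' * y) by ring.
  have -> : y' * u * y = y' * (u * y) by ring.
  by rewrite e' e; ring.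
Qed.

Lemma hcoord_on_line b x y : (x, y) != 0 :> R * R ->
  on_line b x y -> hcoord x y = b.
Proof.
move=> h e; rewrite -[RHS]hcoord_hrepr; apply/hcoord_eq => //.
  by rewrite -surjective_pairing hrepr_neq0.
by rewrite e mulrC.
Qed.

Lemma on_line_hcoord_self x y : (x, y) != 0 :> R * R ->
  on_line (hcoord x y) x y.
Proof. by move=> h; apply/on_line_hcoord => //; rewrite mulrC. Qed.

(** With [double_sin], the cosine and sine of twice the angle of v. They only
depend on the real line through v, and they determine it; so they embed the
projective line in the plane, as the unit circle. *)
Definition double_cos (v : R * R) : R := (v.1 ^+ 2 - v.2 ^+ 2) / (v.1 ^+ 2 + v.2 ^+ 2).
Definition double_sin (v : R * R) : R := (2 * v.1 * v.2) / (v.1 ^+ 2 + v.2 ^+ 2).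
Definition line_cos b := double_cos (hrepr b).
Definition line_sin b := double_sin (hrepr b).

Lemma continuous_fst_punctured (v : set_type (@punctured_plane R)) :
  continuous_at v (fun v : set_type (@punctured_plane R) => (val v).1).
Proof.
apply: (@continuous_comp _ _ _ set_val (@fst R R)).
  exact: set_val_continuous.
exact: cvg_fst.
Qed.

Lemma continuous_snd_punctured (v : set_type (@punctured_plane R)) :
  continuous_at v (fun v : set_type (@punctured_plane R) => (val v).2).
Proof.
apply: (@continuous_comp _ _ _ set_val (@snd R R)).
  exact: set_val_continuous.
exact: cvg_snd.
Qed.

Lemma line_cos_continuous : continuous line_cos.
Proof.
apply: (@repr_comp_continuous _ {eq_quot (same_line_equiv_rel R)} R (fun v => double_cos (val v))).
- move=> v; have n0 : (val v).1 ^+ 2 + (val v).2 ^+ 2 != 0.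
    rewrite gt_eqF// sqr_norm_gt0// -surjective_pairing.
    by have /set_mem := valP v.
  have c1 := @continuous_fst_punctured v; have c2 := @continuous_snd_punctured v.
  suff : continuous_at v (fun v : set_type (@punctured_plane R) =>
    ((val v).1 ^+ 2 - (val v).2 ^+ 2) / ((val v).1 ^+ 2 + (val v).2 ^+ 2)) by [].
  apply: continuous_atM; first by apply: continuous_atB; exact: continuous_atX.
  by apply: continuous_atV => //; apply: continuous_atD; exact: continuous_atX.
- move=> v w /eqP /eqmodP/asboolP [t t0 ->]; rewrite /double_cos /=.
  have n0 : (val v).1 ^+ 2 + (val v).2 ^+ 2 != 0.
    rewrite gt_eqF// sqr_norm_gt0// -surjective_pairing.
    by have /set_mem := valP v.
  rewrite !exprMn -mulrBr -mulrDr invfM mulrACA divff ?mul1r//.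
  by rewrite expf_neq0.
Qed.

Lemma line_sin_continuous : continuous line_sin.
Proof.
apply: (@repr_comp_continuous _ {eq_quot (same_line_equiv_rel R)} R (fun v => double_sin (val v))).
- move=> v; have n0 : (val v).1 ^+ 2 + (val v).2 ^+ 2 != 0.
    rewrite gt_eqF// sqr_norm_gt0// -surjective_pairing.
    by have /set_mem := valP v.
  have c1 := @continuous_fst_punctured v; have c2 := @continuous_snd_punctured v.
  suff : continuous_at v (fun v : set_type (@punctured_plane R) =>
    (2 * (val v).1 * (val v).2) / ((val v).1 ^+ 2 + (val v).2 ^+ 2)) by [].
  apply: continuous_atM; first by apply: continuous_atM => //; apply: continuous_atM => //; exact: continuous_at_cst.
  by apply: continuous_atV => //; apply: continuous_atD; exact: continuous_atX.
- move=> v w /eqP /eqmodP/asboolP [t t0 ->]; rewrite /double_sin /=.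
  rewrite !exprMn -mulrDr invfM.
  have -> : 2 * (t * (val v).1) * (t * (val v).2) = t ^+ 2 * (2 * (val v).1 * (val v).2) by ring.
  by rewrite mulrACA divff ?mul1r// expf_neq0.
Qed.

(** The matrix with rows (c, s) and (s, - c), where (c, s) is the double angle
of (u, v), is the orthogonal reflection in the line through (u, v). *)
Lemma reflection_fixed (u v x y : R) : (u, v) != 0 :> R * R ->
  x * v = y * u <-> double_cos (u, v) * x + double_sin (u, v) * y = x /\
                    double_sin (u, v) * x - double_cos (u, v) * y = y.
Proof.
rewrite /double_cos /double_sin /= => /sqr_norm_gt0 /lt0r_neq0 n0.
split=> [e|[e1 e2]]; last first.
  have e1' : v * (x * v - y * u) = 0.
    have : (u ^+ 2 + v ^+ 2) * x = (u ^+ 2 - v ^+ 2) * x + 2 * u * v * y.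
      by rewrite -[in LHS]e1; field.
    by move=> h; apply: (mulfI (_ : 2 != 0 :> R)); [by rewrite pnatr_eq0|lra].
  have e2' : u * (x * v - y * u) = 0.
    have : (u ^+ 2 + v ^+ 2) * y = 2 * u * v * x - (u ^+ 2 - v ^+ 2) * y.
      by rewrite -[in LHS]e2; field.
    by move=> h; apply: (mulfI (_ : 2 != 0 :> R)); [by rewrite pnatr_eq0|lra].
  apply/eqP; rewrite -subr_eq0 -(mulrI_eq0 _ (mulfI n0)) mulrDl !expr2 -!mulrA.
  by rewrite e1' e2' !mulr0 addr0.
split.
  have -> : (u ^+ 2 - v ^+ 2) / (u ^+ 2 + v ^+ 2) * x
    + 2 * u * v / (u ^+ 2 + v ^+ 2) * y
    = ((u ^+ 2 - v ^+ 2) * x + 2 * v * (y * u)) / (u ^+ 2 + v ^+ 2) by field.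
  by rewrite -e; field.
have -> : 2 * u * v / (u ^+ 2 + v ^+ 2) * x - (u ^+ 2 - v ^+ 2) / (u ^+ 2 + v ^+ 2) * y
   = (2 * u * (x * v) - (u ^+ 2 - v ^+ 2) * y) / (u ^+ 2 + v ^+ 2) by field.
by rewrite e; field.
Qed.

Lemma double_angle_collinear (u v u' v' : R) : (u, v) != 0 :> R * R ->
  (u', v') != 0 :> R * R -> double_cos (u, v) = double_cos (u', v') ->
  double_sin (u, v) = double_sin (u', v') -> u * v' = v * u'.
Proof.
move=> n0 n0' ec es; apply/(reflection_fixed _ _ n0'); rewrite -ec -es.
by apply/(reflection_fixed _ _ n0); rewrite mulrC.
Qed.

Lemma double_angle_circle (u v : R) : (u, v) != 0 :> R * R ->
  @circle R (double_cos (u, v), double_sin (u, v)).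
Proof.
by rewrite /circle /double_cos /double_sin /= => /sqr_norm_gt0 /lt0r_neq0 n0; field.
Qed.

Lemma half_angle (c : R * R) : @circle R c -> exists t r,
  [/\ (t, r) != 0 :> R * R, double_cos (t, r) = c.1 & double_sin (t, r) = c.2].
Proof.
case: c => c s; rewrite /circle /double_cos /double_sin /= => e.
have [c1|c1] := eqVneq (1 + c) 0.
  have cE : c = -1 by apply/eqP; rewrite -addr_eq0 addrC c1.
  have : s ^+ 2 = 0.
    by apply: (addrI (c ^+ 2)); rewrite e cE sqrrN expr1n addr0.
  move=> /eqP; rewrite sqrf_eq0 => /eqP ->.
  exists 0, 1; rewrite pair_neq0 oner_eq0 orbT; split=> //.
    by rewrite cE expr0n expr1n /= !add0r divr1.
  by rewrite mulr0 !mul0r.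
have nE : (1 + c) ^+ 2 + s ^+ 2 = 2 * (1 + c).
  by have -> : s ^+ 2 = 1 - c ^+ 2; [rewrite -e; ring|ring].
have n0 : 2 * (1 + c) != 0 by rewrite mulf_neq0// pnatr_eq0.
(* (1 + c, s) is the sum of (1, 0) and (c, s), so it bisects their angle *)
exists (1 + c), s; rewrite pair_neq0 c1; split=> //; rewrite nE.
  have -> : s ^+ 2 = 1 - c ^+ 2 by rewrite -e; ring.
  by field.
by field.
Qed.

(** Unlike the definition of [on_line], these equations have coefficients that
depend continuously on the line b; they show that incidence is closed. *)
Lemma on_line_reflection b x y : on_line b x y <->
  (line_cos b * x + line_sin b * y = x /\ line_sin b * x - line_cos b * y = y).
Proof.
rewrite /on_line /line_cos /line_sin; have := hrepr_neq0 b.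
by case: (hrepr b) => u v /=; exact: reflection_fixed.
Qed.

Lemma line_angle_inj b b' : line_cos b = line_cos b' -> line_sin b = line_sin b' -> b = b'.
Proof.
move=> ec es; rewrite -[LHS]hcoord_hrepr; apply: hcoord_on_line.
  by rewrite -surjective_pairing hrepr_neq0.
apply/on_line_reflection; rewrite -ec -es; apply/on_line_reflection.
by rewrite /on_line mulrC.
Qed.

Lemma RP1_hausdorff : hausdorff_space (RP1 R).
Proof.
apply: (@injective_continuous_hausdorff _ (R * R)%type
  (fun b => (line_cos b, line_sin b))).
- apply: norm_hausdorff.
- by move=> b; apply: continuous_at_pair; [exact: line_cos_continuous|exact: line_sin_continuous].
- by move=> b b' [ec es]; exact: line_angle_inj.
Qed.

Lemma hcoord_continuous (T : topologicalType) (f g : T -> R) (t : T) :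
  continuous_at t f -> continuous_at t g -> (f t, g t) != 0 :> R * R ->
  continuous_at t (fun t => hcoord (f t) (g t)).
Proof.
move=> cf cg n0.
have cfg : (fun t => (f t, g t)) @ t --> (f t, g t) by exact: continuous_at_pair.
pose r s : set_type (@punctured_plane R) :=
  insubd (exist _ (1, 0) (punctured_plane10 R)) (f s, g s).
suff cr : continuous_at t r.
  exact: (@continuous_at_comp _ _ (RP1 R) r _ t cr (@pi_continuous _ _ (r t))).
move=> A; rewrite nbhsE => -[_ [[U oU <-] Ut UA]].
have : \forall s \near t, U (f s, g s).
  apply: cfg; apply: open_nbhs_nbhs; split=> //.
  by move: Ut; rewrite /= set_valE /r val_insubd_punctured.
have : \forall s \near t, (f s, g s) != 0 :> R * R.
  apply: (cfg [set p | p != 0]); apply: open_nbhs_nbhs; split=> //.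
  rewrite (_ : [set p | p != 0] = ~` [set (0 : R * R)]); last first.
    by apply/seteqP; split=> p /= /eqP.
  apply: closed_openC; apply: accessible_closed_set1.
  apply: hausdorff_accessible; exact: norm_hausdorff.
apply: (@filterS2 _ (nbhs t)) => s ns Us; apply: UA => /=.
by rewrite set_valE /r val_insubd_punctured.
Qed.

(** Each line has a representative (1, t) or (t, 1) with t in [-1, 1]. *)
Lemma RP1_compact : compact [set: RP1 R].
Proof.
pose f (t : R) := hcoord 1 t; pose g (t : R) := hcoord t 1.
have n1 (t : R) : (1, t) != 0 :> R * R by rewrite pair_neq0 oner_eq0.
have n2 (t : R) : (t, 1) != 0 :> R * R by rewrite pair_neq0 oner_eq0 orbT.
have -> : [set: RP1 R] = f @` `[-1, 1] `|` g @` `[-1, 1].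
  apply/seteqP; split=> // b _; have := hrepr_neq0 b; have := hcoord_hrepr b.
  case: (hrepr b) => u v /= <- uv.
  have [vu|uv'] := leP `|v| `|u|; [left|right].
    have u0 : u != 0.
      move: uv; rewrite pair_neq0; case/orP => // v0.
      by rewrite -normr_gt0 (lt_le_trans _ vu)// normr_gt0.
    exists (v / u); last by apply/hcoord_eq; rewrite // mul1r mulrC divfK.
    by rewrite /= in_itv /= -ler_norml normrM normfV ler_pdivrMr ?normr_gt0// mul1r.
  have v0 : v != 0 by rewrite -normr_gt0 (le_lt_trans _ uv').
  exists (u / v); last by apply/hcoord_eq; rewrite // mulr1 divfK.
  by rewrite /= in_itv /= -ler_norml normrM normfV ler_pdivrMr ?normr_gt0// mul1r ltW.
apply: compactU; apply: continuous_compact; try exact: segment_compact.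
  apply: continuous_subspaceT => t; apply: hcoord_continuous => //.
  exact: cvg_cst.
apply: continuous_subspaceT => t; apply: hcoord_continuous => //.
exact: cvg_cst.
Qed.

End ProjectiveLine.

(** * Real lines in the fibres of the rolled coamoeba map *)

Section Projector.
Variables (R : realType) (n : nat).
Implicit Types (h : 'rV[R]_n).

Definition dot h h' : R := \sum_i h 0 i * h' 0 i.

(** The orthogonal projector onto the line spanned by h: it stands for the
point of real projective space given by h. *)
Definition projector h : 'M[R]_n := \matrix_(i, j) (h 0 i * h 0 j / dot h h).

Lemma dot_gt0 h : h != 0 -> 0 < dot h h.
Proof.
move=> /rV0Pn [i hi]; rewrite /dot (bigD1 i)//=; apply: ltr_pwDl.
  by rewrite -expr2 exprn_even_gt0.
by apply: sumr_ge0 => j _; rewrite -expr2 sqr_ge0.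
Qed.

Lemma dotZl c h h' : dot (c *: h) h' = c * dot h h'.
Proof. by rewrite /dot mulr_sumr; apply: eq_bigr => i _; rewrite mxE mulrA. Qed.

Lemma dotC h h' : dot h h' = dot h' h.
Proof. by apply: eq_bigr => i _; rewrite mulrC. Qed.

Lemma dotDl h1 h2 h' : dot (h1 + h2) h' = dot h1 h' + dot h2 h'.
Proof. by rewrite /dot -big_split; apply: eq_bigr => i _; rewrite mxE mulrDl. Qed.

Lemma projectorZ c h : c != 0 -> projector (c *: h) = projector h.
Proof.
move=> c0; apply/matrixP => i j; rewrite !mxE dotZl dotC dotZl.
have -> : c * h 0 i * (c * h 0 j) = (c * c) * (h 0 i * h 0 j) by ring.
by rewrite [c * (c * _)]mulrA invfM mulrACA divff ?mulf_neq0// mul1r.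
Qed.

Lemma projector_inj h h' : h != 0 -> h' != 0 ->
  projector h = projector h' -> exists2 c, c != 0 & h' = c *: h.
Proof.
move=> h0 h'0 e; have d0 := dot_gt0 h0; have d'0 := dot_gt0 h'0.
have [i hi] : exists i, h' 0 i != 0 by apply/rV0Pn.
have H : h' = (dot h' h' * h 0 i / dot h h / h' 0 i) *: h.
  apply/rowP => j; rewrite !mxE.
  have /matrixP/(_ i j) := e; rewrite !mxE => eij.
  transitivity ((h' 0 i * h' 0 j / dot h' h') * dot h' h' / h' 0 i).
    by field; rewrite hi gt_eqF.
  by rewrite -eij; field; rewrite hi gt_eqF.
exists (dot h' h' * h 0 i / dot h h / h' 0 i) => //.
by apply: contraNneq h'0 => c0; rewrite H c0 scale0r.
Qed.

Lemma projector_mul_eq0 h (v : 'cV[R]_n) : h != 0 ->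
  (forall i, (projector h *m v) i 0 = 0) <-> (h *m v) 0 0 = 0.
Proof.
move=> h0; have d0 := dot_gt0 h0.
have E i : (projector h *m v) i 0 = h 0 i / dot h h * (h *m v) 0 0.
  rewrite !mxE mulr_sumr; apply: eq_bigr => j _; rewrite mxE; field.
  by rewrite gt_eqF.
split=> [H|H i]; last by rewrite E H mulr0.
have /rV0Pn [i hi] := h0; have := H i; rewrite E => /eqP.
by rewrite mulf_eq0 mulf_eq0 invr_eq0 (negbTE hi) gt_eqF //= => /eqP.
Qed.

End Projector.

Lemma neq0_pairP (R : realType) (x y : R) :
  ((x, y) != 0 :> R * R) <-> ~ (x = 0 /\ y = 0).
Proof.
split=> [/eqP h [x0 y0]|h]; first by apply: h; rewrite x0 y0.
by apply/eqP => -[x0 y0]; apply: h.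
Qed.

Section Pencil.
Variables (R : realType) (X Y : 'M[R]_5).
Implicit Types (b : RP1_4 R) (h : 'rV[R]_5) (k : 'I_5).

(** The line allowed for the form of index k: the given one for k > 0, and the
real axis for k = 0, since the homogenizing form is real. *)
Definition line_at b k : RP1 R :=
  if unlift ord0 k is Some j then b j else hcoord 1 0.

(** The columns of X and Y hold the real and imaginary parts of the five forms
F_k, so that this is the space W_b. *)
Definition fiber b : set 'rV[R]_5 :=
  [set h | forall k, on_line (line_at b k) ((h *m X) 0 k) ((h *m Y) 0 k)].

Definition vanishing k : set 'rV[R]_5 :=
  [set h | (h *m X) 0 k = 0 /\ (h *m Y) 0 k = 0].

(** That is, dim W_b >= 2; these b turn out to be the critical values
([critical_valuesE]). *)
Definition critical_direction b : Prop := exists h h',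
  [/\ fiber b h, fiber b h', h != 0 & forall c, h' <> c *: h].

Lemma mul_row_lin (Z : 'M[R]_5) (s t : R) h h' k :
  ((s *: h + t *: h') *m Z) 0 k = s * (h *m Z) 0 k + t * (h' *m Z) 0 k.
Proof. by rewrite mulmxDl -!scalemxAl !mxE. Qed.

Lemma fiber_lin b s t h h' : fiber b h -> fiber b h' ->
  fiber b (s *: h + t *: h').
Proof.
by move=> fh fh' k; rewrite !mul_row_lin; apply: on_line_lin.
Qed.

Lemma fiberZ b s h : fiber b h -> fiber b (s *: h).
Proof. by move=> fh; have := fiber_lin s 0 fh fh; rewrite scale0r addr0. Qed.

Lemma vanishingZ k s h : vanishing k h -> vanishing k (s *: h).
Proof. by move=> [hx hy]; split; rewrite -scalemxAl mxE ?hx ?hy mulr0. Qed.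

(** On W_b the form F_k takes its values on a real line, so it behaves as a
real-valued form, and one can eliminate. *)
Lemma fiber_reduce b k h h' : fiber b h -> fiber b h' -> ~ vanishing k h ->
  exists c, vanishing k (h' - c *: h).
Proof.
move=> fh fh' /neq0_pairP n0.
have [c [ex ey]] := on_line_collinear (fh k) (fh' k) n0.
exists c; split.
  by rewrite -[h']scale1r -scaleNr mul_row_lin ex mul1r mulNr subrr.
by rewrite -[h']scale1r -scaleNr mul_row_lin ey mul1r mulNr subrr.
Qed.

Lemma critical_vanishing b k : critical_direction b ->
  exists h, [/\ h != 0, fiber b h & vanishing k h].
Proof.
move=> [h [h' [fh fh' h0 indep]]].
have [vh|nvh] := pselect (vanishing k h); first by exists h.
have [c vc] := fiber_reduce fh fh' nvh; exists (h' - c *: h); split=> //.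
- by rewrite subr_eq0; apply/eqP; exact: indep.
- by rewrite -[h']scale1r -scaleNr; apply: fiber_lin.
Qed.

Lemma critical_independent b h : critical_direction b -> exists2 h', fiber b h' &
  forall c, h' <> c *: h.
Proof.
move=> [g [g' [fg fg' g0 indep]]]; apply: contrapT => H.
have V u : fiber b u -> exists c, u = c *: h.
  move=> fu; apply: contrapT => nu; apply: H; exists u => // c e.
  by apply: nu; exists c.
have [c1 e1] := V _ fg; have [c2 e2] := V _ fg'.
have c10 : c1 != 0 by apply: contraNneq g0 => c0; rewrite e1 c0 scale0r.
by apply: (indep (c2 / c1)); rewrite e1 scalerA divfK.
Qed.

Hypothesis generic : forall b k h h', fiber b h -> fiber b h' ->
  vanishing k h -> vanishing k h' -> h != 0 -> exists c, h' = c *: h.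

Lemma critical_nonvanishing b k : critical_direction b ->
  exists2 h, fiber b h & ~ vanishing k h.
Proof.
move=> [h [h' [fh fh' h0 indep]]]; apply: contrapT => H.
have V g : fiber b g -> vanishing k g.
  by move=> fg; apply: contrapT => ng; apply: H; exists g.
have [c e] := generic fh fh' (V _ fh) (V _ fh') h0.
exact: (indep c).
Qed.

(** A real line of W_b is given by its projector, so that the total space lies
in a Hausdorff space and comes with a projection to the base. *)
Definition bundle_space : set (RP1_4 R * 'M[R]_5) :=
  [set x | critical_direction x.1 /\ exists h, [/\ h != 0, fiber x.1 h & x.2 = projector h]].

Definition orthonormal_pairs : set (RP1_4 R * ('rV[R]_5 * 'rV[R]_5)) :=
  [set q | [/\ fiber q.1 q.2.1, fiber q.1 q.2.2, dot q.2.1 q.2.1 = 1,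
     dot q.2.2 q.2.2 = 1 & dot q.2.1 q.2.2 = 0]].

Lemma line_at_continuous k : continuous (line_at^~ k).
Proof.
rewrite /line_at; case: unliftP => [j _|_].
  exact: ptws_proj_continuous.
exact: cst_continuous.
Qed.

Lemma mul_entry_continuous (T : topologicalType) (f : T -> 'rV[R]_5)
  (Z : 'M[R]_5) k : continuous f -> continuous (fun t => (f t *m Z) 0 k).
Proof.
move=> cf t.
apply: (@continuous_at_ext _ _ (fun t => \sum_i f t 0 i * Z i k)); last first.
  by move=> s; rewrite mxE.
apply: continuous_at_sum => i _; apply: continuous_atM; last exact: continuous_at_cst.
by apply: (@continuous_at_comp _ _ _ f (fun M => M 0 i)); [exact: cf|exact: continuous_entry].
Qed.

Lemma fiber_closed (T : topologicalType) (f : T -> RP1_4 R) (g : T -> 'rV[R]_5) :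
  continuous f -> continuous g -> closed [set t | fiber (f t) (g t)].
Proof.
move=> cf cg.
have cl k : continuous (fun t => line_at (f t) k).
  by move=> t; apply: (@continuous_at_comp _ _ _ f (line_at^~ k)); [exact: cf|exact: line_at_continuous].
have cc k : continuous (fun t => line_cos (line_at (f t) k)).
  by move=> t; apply: (@continuous_at_comp _ _ _ _ (@line_cos R)); [exact: cl|exact: line_cos_continuous].
have cs k : continuous (fun t => line_sin (line_at (f t) k)).
  by move=> t; apply: (@continuous_at_comp _ _ _ _ (@line_sin R)); [exact: cl|exact: line_sin_continuous].
have cX k := @mul_entry_continuous T g X k cg.
have cY k := @mul_entry_continuous T g Y k cg.
apply: (@closed_forall _ _ (fun k => [set t |
  on_line (line_at (f t) k) ((g t *m X) 0 k) ((g t *m Y) 0 k)])) => k.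
rewrite (_ : [set t | _] =
  [set t | line_cos (line_at (f t) k) * (g t *m X) 0 k + line_sin (line_at (f t) k) * (g t *m Y) 0 k = (g t *m X) 0 k] `&`
  [set t | line_sin (line_at (f t) k) * (g t *m X) 0 k - line_cos (line_at (f t) k) * (g t *m Y) 0 k = (g t *m Y) 0 k]).
  apply: closedI; (apply: closed_real_eq; last by []) => t.
    apply: continuous_atD; apply: continuous_atM; [exact: cc|exact: cX|exact: cs|exact: cY].
  apply: continuous_atB; apply: continuous_atM; [exact: cs|exact: cX|exact: cc|exact: cY].
by apply/seteqP; split=> t /= => [/on_line_reflection|?]; last exact/on_line_reflection.
Qed.

Lemma dot_continuous (T : topologicalType) (f g : T -> 'rV[R]_5) :
  continuous f -> continuous g -> continuous (fun t => dot (f t) (g t)).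
Proof.
move=> cf cg t; apply: continuous_at_sum => i _; apply: continuous_atM.
  by apply: (@continuous_at_comp _ _ _ f (fun M => M 0 i)); [exact: cf|exact: continuous_entry].
by apply: (@continuous_at_comp _ _ _ g (fun M => M 0 i)); [exact: cg|exact: continuous_entry].
Qed.

Lemma sphere_compact : compact [set h : 'rV[R]_5 | dot h h = 1].
Proof.
apply: bounded_closed_compact; last first.
  apply: closed_real_eq; last by move=> h; exact: continuous_at_cst.
  by apply: dot_continuous => h; exact: cvg_id.
exists 1; split; first exact: num_real.
move=> M M1 h /= h1; rewrite -[`|h|]/(mx_norm h) mx_normrE; apply/bigmax_leP.
split; first by rewrite ltW// (lt_trans _ M1).
move=> [i j] _ /=; rewrite ord1; apply: le_trans (ltW M1).
rewrite -(@ler_pXn2r _ 2)// ?nnegrE// expr1n -normrX ger0_norm ?sqr_ge0//.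
rewrite -h1 /dot (bigD1 j)//= -expr2 lerDl.
by apply: sumr_ge0 => l _; rewrite -expr2 sqr_ge0.
Qed.

Lemma orthonormal_pairs_compact : compact orthonormal_pairs.
Proof.
pose S := [set h : 'rV[R]_5 | dot h h = 1].
have cK : compact ([set: RP1_4 R] `*` (S `*` S)).
  apply: compact_setX; last by apply: compact_setX; exact: sphere_compact.
  rewrite (_ : [set: RP1_4 R] = [set f : forall i : 'I_4, RP1 R | forall i, [set: RP1 R] (f i)]).
    exact: (@tychonoff 'I_4 (fun=> RP1 R) (fun=> setT) (fun=> @RP1_compact R)).
  by apply/seteqP.
apply: (subclosed_compact _ cK); last by move=> [b [h h']] [/= _ _ hh hh' _].
have c1 : continuous (fun q : RP1_4 R * ('rV[R]_5 * 'rV[R]_5) => q.1) by exact: continuous_fst.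
have c2 : continuous (fun q : RP1_4 R * ('rV[R]_5 * 'rV[R]_5) => q.2.1).
  by move=> q; apply: (@continuous_at_comp _ _ _ snd fst); [exact: continuous_snd|exact: continuous_fst].
have c3 : continuous (fun q : RP1_4 R * ('rV[R]_5 * 'rV[R]_5) => q.2.2).
  by move=> q; apply: (@continuous_at_comp _ _ _ snd snd); [exact: continuous_snd|exact: continuous_snd].
rewrite (_ : orthonormal_pairs = [set q | fiber q.1 q.2.1] `&` [set q | fiber q.1 q.2.2] `&`
  [set q | dot q.2.1 q.2.1 = 1] `&` [set q | dot q.2.2 q.2.2 = 1] `&` [set q | dot q.2.1 q.2.2 = 0]).
  have cl1 := fiber_closed c1 c2; have cl2 := fiber_closed c1 c3.
  have cst (r : R) : continuous (fun q : RP1_4 R * ('rV[R]_5 * 'rV[R]_5) => r).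
    by move=> q; exact: continuous_at_cst.
  have cl3 := closed_real_eq (dot_continuous c2 c2) (cst 1).
  have cl4 := closed_real_eq (dot_continuous c3 c3) (cst 1).
  have cl5 := closed_real_eq (dot_continuous c2 c3) (cst 0).
  exact: (closedI (closedI (closedI (closedI cl1 cl2) cl3) cl4) cl5).
by apply/seteqP; split=> q /= => [[]//|[[[[]]]]].
Qed.

Lemma normalize_unit h : h != 0 -> exists2 c, c != 0 & dot (c *: h) (c *: h) = 1.
Proof.
move=> h0; have d0 := dot_gt0 h0; exists (Num.sqrt (dot h h))^-1.
  by rewrite invr_eq0 gt_eqF// sqrtr_gt0.
rewrite dotZl dotC dotZl mulrA -invfM -expr2 sqr_sqrtr ?ltW// mulVf//.
by rewrite gt_eqF.
Qed.

(** By the Gram-Schmidt process, a line of W_b extends to an orthonormal pair as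
soon as dim W_b >= 2. *)
Lemma bundle_spaceE : bundle_space = (fun q : RP1_4 R * ('rV[R]_5 * 'rV[R]_5) =>
  (q.1, projector q.2.1)) @` orthonormal_pairs.
Proof.
apply/seteqP; split=> [[b P] [/= cb [h [h0 fh ->]]]|_ [[b [h h']] [/= fh fh' h1 h'1 hh'] <-]].
  have [h2 fh2 nh2] := critical_independent h cb.
  have d0 := dot_gt0 h0.
  pose h' := h2 - (dot h h2 / dot h h) *: h.
  have fh' : fiber b h'.
    by rewrite /h' -[h2]scale1r -scaleNr; apply: fiber_lin.
  have h'0 : h' != 0 by rewrite subr_eq0; apply/eqP; exact: nh2.
  have hh' : dot h h' = 0.
    rewrite dotC /h' -scaleNr dotDl dotZl [dot h2 h]dotC.
    by rewrite mulNr divfK ?subrr// gt_eqF.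
  have [c c0 hc] := normalize_unit h0; have [c' c'0 hc'] := normalize_unit h'0.
  exists (b, (c *: h, c' *: h')); last by rewrite /= projectorZ.
  split=> //=; try exact: fiberZ.
  by rewrite dotZl dotC dotZl dotC hh' !mulr0.
have h0 : h != 0.
  apply/eqP => h0; move: h1; rewrite h0 /dot.
  rewrite big1 => [/esym/eqP|i _]; first by rewrite oner_eq0.
  by rewrite mxE mul0r.
split=> /=; last by exists h.
exists h, h'; split=> // c e; move: hh' h'1; rewrite e dotC dotZl h1 mulr1 => ->.
rewrite scale0r /dot big1 => [/esym/eqP|i _]; first by rewrite oner_eq0.
by rewrite mxE mul0r.
Qed.

End Pencil.

(** * The circle bundle and its five sections *)

Section Bundle.
Variables (R : realType) (X Y : 'M[R]_5).
Implicit Types (b : RP1_4 R) (h : 'rV[R]_5) (k : 'I_5).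
Local Notation fiber := (fiber X Y).
Local Notation vanishing := (vanishing X Y).
Local Notation critical_direction := (critical_direction X Y).
Local Notation bundle_space := (bundle_space X Y).

Hypothesis generic : forall b k h h', fiber b h -> fiber b h' ->
  vanishing k h -> vanishing k h' -> h != 0 -> exists c, h' = c *: h.
Hypothesis X0 : forall h, (h *m X) 0 ord0 = h 0 ord0.
Hypothesis Y0 : forall h, (h *m Y) 0 ord0 = 0.

Let B : set (RP1_4 R) := [set b | critical_direction b].
Let E := set_type bundle_space.

Lemma critical_total (x : E) : B (set_val x).1.
Proof. by have [] := set_valP x. Qed.

Definition proj_base (x : E) : set_type B := sub_elt (critical_total x).

Lemma proj_base_val x : set_val (proj_base x) = (set_val x).1.
Proof. by rewrite set_valE. Qed.

Lemma proj_base_continuous : continuous proj_base.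
Proof.
apply: continuous_to_sub => x.
apply: (@continuous_at_comp _ _ _ set_val fst); last exact: continuous_fst.
exact: set_val_continuous.
Qed.

Lemma projector_continuous_at (T : topologicalType) (f : T -> 'rV[R]_5) t :
  continuous_at t f -> f t != 0 -> continuous_at t (fun s => projector (f s)).
Proof.
move=> cf n0.
have ce i : continuous_at t (fun s => f s 0 i).
  by apply: (@continuous_at_comp _ _ _ f (fun M => M 0 i)) => //; exact: continuous_entry.
apply: continuous_at_mx => i j.
apply: (@continuous_at_ext _ _ (fun s => f s 0 i * f s 0 j / \sum_k f s 0 k * f s 0 k)).
  apply: continuous_atM; first by apply: continuous_atM; exact: ce.
  apply: continuous_atV; last by rewrite gt_eqF// (dot_gt0 n0).
  by apply: continuous_at_sum => k _; apply: continuous_atM; exact: ce.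
by move=> s; rewrite mxE.
Qed.

(** The compactness of the set of orthonormal pairs also accounts for the base:
the set of critical values is closed because it is a projection of it. *)
Lemma bundle_space_compact : compact [set: E].
Proof.
apply: compact_set_type; rewrite bundle_spaceE.
apply: continuous_compact; last exact: orthonormal_pairs_compact.
apply/subspace_sigL_continuousP.
suff : continuous (fun q : set_type (orthonormal_pairs X Y) =>
  ((set_val q).1, projector (set_val q).2.1)) by [].
move=> q; apply: continuous_at_pair.
  by apply: (@continuous_at_comp _ _ _ set_val fst); [exact: set_val_continuous|exact: continuous_fst].
apply: projector_continuous_at.
  apply: (@continuous_at_comp _ _ _ (fun q : set_type (orthonormal_pairs X Y) => (set_val q).2) fst); last exact: continuous_fst.
  by apply: (@continuous_at_comp _ _ _ set_val snd); [exact: set_val_continuous|exact: continuous_snd].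
have [_ _ h1 _ _] := set_valP q.
apply/eqP => h0; move: h1; rewrite h0 /dot big1 => [/esym/eqP|i _].
  by rewrite oner_eq0.
by rewrite mxE mul0r.
Qed.

Lemma bundle_space_hausdorff : hausdorff_space E.
Proof.
apply: set_type_hausdorff; apply: hausdorff_prod.
  by apply: ptws_hausdorff; exact: RP1_hausdorff.
exact: norm_hausdorff.
Qed.

(** The form F_k vanishes on the line, expressed through its projector so that
the condition is visibly closed. *)
Definition on_divisor k (x : E) : Prop := forall i,
  ((set_val x).2 *m X) i k = 0 /\ ((set_val x).2 *m Y) i k = 0.

Lemma projector_vanishing k h : h != 0 ->
  (forall i, (projector h *m X) i k = 0 /\ (projector h *m Y) i k = 0) <->
  vanishing k h.
Proof.
move=> h0.
have A Z : (forall i, (projector h *m Z) i k = 0) <-> (h *m Z) 0 k = 0.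
  have e m (M : 'M[R]_(m, 5)) i : (M *m Z) i k = (M *m col k Z) i 0.
    by rewrite !mxE; apply: eq_bigr => j _; rewrite mxE.
  rewrite e; apply: (iff_trans _ (projector_mul_eq0 (col k Z) h0)).
  by split=> H i; have := H i; rewrite e.
split=> [H|[/A hx /A hy] i //].
by split; apply/A => i; have [] := H i.
Qed.

Lemma section_ex k (b : set_type B) :
  exists x, proj_base x = b /\ on_divisor k x.
Proof.
have [h [h0 fh vh]] := critical_vanishing k (set_valP b).
have tot : bundle_space (set_val b, projector h).
  by split=> /=; [exact: set_valP|exists h].
exists (sub_elt tot); split.
  by apply: val_inj; rewrite /= set_valE.
by move=> i; rewrite set_valE; exact: (iffRL (projector_vanishing k h0) vh i).
Qed.

Lemma bundle_space_eq x y : proj_base x = proj_base y ->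
  (set_val x).2 = (set_val y).2 -> x = y.
Proof.
move=> exy1 exy2; apply: val_inj; move: exy2.
have := congr1 set_val exy1; rewrite !proj_base_val !set_valE.
by case: (val x) => ? ?; case: (val y) => ? ? /= -> ->.
Qed.

Lemma on_divisor_unique k x y : proj_base x = proj_base y ->
  on_divisor k x -> on_divisor k y -> x = y.
Proof.
move=> exy dx dy; apply: bundle_space_eq => //.
have [_ [h [h0 fh eh]]] := set_valP x.
have [_ [g [g0 fg eg]]] := set_valP y.
have e : (set_val x).1 = (set_val y).1 by rewrite -!proj_base_val exy.
have vh : vanishing k h by apply/(projector_vanishing k h0); rewrite -eh.
have vg : vanishing k g by apply/(projector_vanishing k g0); rewrite -eg.
rewrite -e in fg; have [c ec] := generic fh fg vh vg h0.
rewrite eh eg ec projectorZ//; apply: contraNneq g0 => c0.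
by rewrite ec c0 scale0r.
Qed.

(** The line of W_b on which F_k vanishes; for k = 0 it consists of points at
infinity. *)
Definition sec k (b : set_type B) : E := sval (cid (section_ex k b)).

Lemma secK k : cancel (sec k) proj_base.
Proof. by move=> b; rewrite /sec; case: cid => x []. Qed.

Lemma sec_on_divisor k (b : set_type B) : on_divisor k (sec k b).
Proof. by rewrite /sec; case: cid => x []. Qed.

Lemma sec_eq k x : on_divisor k x -> sec k (proj_base x) = x.
Proof.
by move=> dx; apply: (@on_divisor_unique k); rewrite ?secK//; exact: sec_on_divisor.
Qed.

Lemma projection_entry_continuous (T : topologicalType) (f : T -> E) i j :
  continuous f -> continuous (fun t => (set_val (f t)).2 i j).
Proof.
move=> cf t; apply: (@continuous_at_comp _ _ _ (fun t => (set_val (f t)).2) (fun M => M i j)); last exact: continuous_entry.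
apply: (@continuous_at_comp _ _ _ (fun t => set_val (f t)) snd); last exact: continuous_snd.
by apply: (@continuous_at_comp _ _ _ f set_val); [exact: cf|exact: set_val_continuous].
Qed.

Lemma on_divisor_closed (T : topologicalType) (f : T -> E) k :
  continuous f -> closed [set t | on_divisor k (f t)].
Proof.
move=> cf.
have cZ (Z : 'M[R]_5) i : closed [set t | ((set_val (f t)).2 *m Z) i k = 0].
  apply: closed_real_eq => t; last exact: continuous_at_cst.
  apply: (@continuous_at_ext _ _ (fun t => \sum_j (set_val (f t)).2 i j * Z j k)); last first.
    by move=> s; rewrite mxE.
  apply: continuous_at_sum => j _; apply: continuous_atM; last exact: continuous_at_cst.
  exact: projection_entry_continuous.
apply: (@closed_forall _ _ (fun i => [set t |
  ((set_val (f t)).2 *m X) i k = 0 /\ ((set_val (f t)).2 *m Y) i k = 0])) => i.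
exact: (closedI (cZ X i) (cZ Y i)).
Qed.

Lemma base_hausdorff : hausdorff_space (set_type B).
Proof.
apply: set_type_hausdorff; apply: ptws_hausdorff; exact: RP1_hausdorff.
Qed.

(** Being on the divisor and lying over b are closed conditions, and they
characterize the value of the section at b. *)
Lemma sec_continuous k : continuous (sec k).
Proof.
apply: closed_graph_continuous; first exact: bundle_space_compact.
rewrite (_ : [set xy | _] = [set xy | proj_base xy.2 = xy.1] `&`
  [set xy | on_divisor k xy.2]).
  apply: closedI; last by apply: on_divisor_closed; exact: continuous_snd.
  apply: closed_equalizer; first exact: base_hausdorff.
    move=> x; apply: (@continuous_at_comp _ _ _ snd proj_base); first exact: continuous_snd.
    exact: proj_base_continuous.
  exact: continuous_fst.
apply/seteqP; split=> -[b x] /= => [->|[<- dx]].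
  by split; [exact: secK|exact: sec_on_divisor].
by rewrite sec_eq.
Qed.

(** The critical values whose point at infinity, the line of W_b in ker F_0,
has a nonzero i-th coordinate. There (h_0, h_i) are coordinates on W_b. *)
Definition chart_domain (i : 'I_5) : set (set_type B) :=
  [set b | (set_val (sec ord0 b)).2 i i != 0].

Lemma vanishing0 h : vanishing ord0 h <-> h 0 ord0 = 0.
Proof. by split=> [[]|h0]; rewrite ?X0//; split; rewrite ?X0 ?Y0. Qed.

Lemma projector_diag h i : h != 0 -> (projector h i i != 0) = (h 0 i != 0).
Proof.
move=> h0; rewrite mxE mulf_eq0 mulf_eq0 orbb invr_eq0.
by rewrite (gt_eqF (dot_gt0 h0)) orbF.
Qed.

Lemma chart_domain_open i : open (chart_domain i).
Proof.
rewrite (_ : chart_domain i = ~` [set b | (set_val (sec ord0 b)).2 i i = 0]).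
  apply: closed_openC; apply: closed_real_eq => b; last exact: continuous_at_cst.
  exact: (projection_entry_continuous (@sec_continuous ord0)).
by apply/seteqP; split=> b /= /eqP.
Qed.

Lemma sec0_spec (b : set_type B) : exists h,
  [/\ h != 0, fiber (set_val b) h, h 0 ord0 = 0 &
      set_val (sec ord0 b) = (set_val b, projector h)].
Proof.
have [_ [h [h0 fh eh]]] := set_valP (sec ord0 b).
have eb : (set_val (sec ord0 b)).1 = set_val b by rewrite -proj_base_val secK.
exists h; split=> //; first by rewrite -eb.
  apply/vanishing0; apply/(projector_vanishing ord0 h0); rewrite -eh.
  exact: sec_on_divisor.
by rewrite -eb -eh -surjective_pairing.
Qed.

Lemma chart_domain_cover (b : set_type B) : exists i, chart_domain i b.
Proof.
have [h [h0 fh hz e]] := sec0_spec b.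
have /rV0Pn [i hi] := h0; exists i.
by rewrite /chart_domain /= e /= projector_diag.
Qed.

(** A vector of W_b with h_0 = 0 is a multiple of the one at infinity, whose
i-th coordinate is nonzero. *)
Lemma chart_coord_inj i (b : set_type B) h : chart_domain i b ->
  fiber (set_val b) h -> h 0 ord0 = 0 -> h 0 i = 0 -> h = 0.
Proof.
have [g [g0 fg gz e]] := sec0_spec b.
rewrite /chart_domain /= e /= projector_diag// => gi fh hz hi.
have [c ec] := generic fg fh (iffRL (vanishing0 g) gz) (iffRL (vanishing0 h) hz) g0.
move/eqP : hi; rewrite ec mxE mulf_eq0 (negbTE gi) orbF => /eqP ->.
by rewrite scale0r.
Qed.

Lemma chart_coord_neq0 i (b : set_type B) h : chart_domain i b ->
  fiber (set_val b) h -> h != 0 -> (h 0 ord0, h 0 i) != 0 :> R * R.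
Proof.
move=> bi fh h0; apply/eqP => -[hz hi]; move/eqP : h0; apply.
exact: (chart_coord_inj bi fh hz hi).
Qed.

Lemma chart_coord_surj i (b : set_type B) (t r : R) : chart_domain i b ->
  exists h, [/\ fiber (set_val b) h, h 0 ord0 = t & h 0 i = r].
Proof.
have [g [g0 fg gz e]] := sec0_spec b.
rewrite /chart_domain /= e /= projector_diag// => gi.
have [h fh nh] := critical_nonvanishing generic ord0 (set_valP b).
have h0 : h 0 ord0 != 0 by apply/eqP => hz; apply: nh; apply/vanishing0.
exists ((t / h 0 ord0) *: h + ((r - t / h 0 ord0 * h 0 i) / g 0 i) *: g); split.
- exact: fiber_lin.
- by rewrite !mxE gz mulr0 addr0 divfK.
- by rewrite !mxE divfK// addrC subrK.
Qed.

(** The double angle of (h_0, h_i), read off the entries of the projector onto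
the line of h. *)
Definition chart_circle i (x : E) : R * R :=
  let P := (set_val x).2 in
  ((P ord0 ord0 - P i i) / (P ord0 ord0 + P i i),
   2 * P ord0 i / (P ord0 ord0 + P i i)).

Lemma chart_circle_spec i x : chart_domain i (proj_base x) -> exists h,
  [/\ h != 0, fiber (set_val (proj_base x)) h, (set_val x).2 = projector h,
    (h 0 ord0, h 0 i) != 0 :> R * R &
  [/\ (set_val x).2 ord0 ord0 + (set_val x).2 i i != 0,
  (chart_circle i x).1 = double_cos (h 0 ord0, h 0 i) &
      (chart_circle i x).2 = double_sin (h 0 ord0, h 0 i)]].
Proof.
move=> xi; have [_ [h [h0 fh eh]]] := set_valP x.
rewrite -proj_base_val in fh; exists h; rewrite /chart_circle eh !mxE /=.
have n0 := chart_coord_neq0 xi fh h0.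
have d0 := dot_gt0 h0.
have s0 := sqr_norm_gt0 n0.
have sE : h 0 ord0 * h 0 ord0 / dot h h + h 0 i * h 0 i / dot h h =
  (h 0 ord0 ^+ 2 + h 0 i ^+ 2) / dot h h by rewrite !expr2 mulrDl.
split=> //; split.
- by rewrite sE gt_eqF// divr_gt0.
- rewrite sE /double_cos /=; field.
  by rewrite !gt_eqF.
- rewrite sE /double_sin /=; field.
  by rewrite !gt_eqF.
Qed.

Lemma chart_circle_inj i x y : chart_domain i (proj_base x) ->
  proj_base x = proj_base y -> chart_circle i x = chart_circle i y -> x = y.
Proof.
move=> xi exy ec; have [h [h0 fh eh nh [_ hc hs]]] := chart_circle_spec xi.
have yi : chart_domain i (proj_base y) by rewrite -exy.
have [g [g0 fg eg ng [_ gc gs]]] := chart_circle_spec yi.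
rewrite -exy in fg.
have e : h 0 ord0 * g 0 i = h 0 i * g 0 ord0.
  by apply: double_angle_collinear; rewrite // -?hc -?hs -?gc -?gs ec.
have [m [m0 mi]] : exists m, g 0 ord0 = m * h 0 ord0 /\ g 0 i = m * h 0 i.
  apply: (@on_line_collinear _ (hcoord (h 0 ord0) (h 0 i))) => //.
    exact: on_line_hcoord_self.
  by apply/on_line_hcoord; rewrite // mulrC -e mulrC.
have gE : g - m *: h = 0.
  apply: (chart_coord_inj xi).
  - by rewrite -[g]scale1r -scaleNr; apply: fiber_lin.
  - by rewrite !mxE m0 subrr.
  - by rewrite !mxE mi subrr.
move/eqP : gE; rewrite subr_eq0 => /eqP gE.
apply: bundle_space_eq => //; rewrite eh eg gE projectorZ//.
by apply: contraNneq g0 => m00; rewrite gE m00 scale0r.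
Qed.

Lemma chart_circle_surj i (b : set_type B) (c : R * R) : chart_domain i b ->
  @circle R c -> exists x, proj_base x = b /\ chart_circle i x = c.
Proof.
move=> bi /half_angle [t [r [n0 ec es]]].
have [h [fh ht hr]] := chart_coord_surj t r bi.
have h0 : h != 0.
  by apply: contraNneq n0 => h0; rewrite -ht -hr h0 !mxE eqxx.
have tot : bundle_space (set_val b, projector h).
  by split=> /=; [exact: set_valP|exists h].
pose x : E := sub_elt tot.
have xb : proj_base x = b by apply: val_inj; rewrite /= set_valE.
exists x; split=> //.
have xi : chart_domain i (proj_base x) by rewrite xb.
have [g [g0 fg eg ng [_ gc gs]]] := chart_circle_spec xi.
have [m m0 ge] : exists2 m, m != 0 & h = m *: g.
  by apply: projector_inj; rewrite // -eg /x set_valE.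
rewrite [LHS]surjective_pairing [RHS]surjective_pairing gc gs -ec -es -ht -hr.
have s0 := lt0r_neq0 (sqr_norm_gt0 ng).
have s1 : (m * g 0 ord0) ^+ 2 + (m * g 0 i) ^+ 2 != 0.
  by rewrite !exprMn -mulrDr mulf_neq0// expf_neq0.
rewrite ge !mxE /double_cos /double_sin /=; congr (_, _).
  by field; rewrite s1 s0.
by field; rewrite s1 s0.
Qed.

Lemma chart_circleP i x : chart_domain i (proj_base x) ->
  @circle R (chart_circle i x).
Proof.
move=> /chart_circle_spec [h [_ _ _ n0 [_ ec es]]].
by rewrite [chart_circle _ _]surjective_pairing ec es; exact: double_angle_circle.
Qed.

Section Trivialization.
Variable i : 'I_5.
Let U := chart_domain i.
Let S1 := set_type (@circle R).

Definition trivialization (x : set_type (proj_base @^-1` U)) : (set_type U * S1)%type :=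
  (sub_elt (set_valP x : U (proj_base (set_val x))),
   sub_elt (chart_circleP (set_valP x))).

Lemma triv_inv_ex (q : (set_type U * S1)%type) : exists x : E,
  proj_base x = set_val q.1 /\ chart_circle i x = set_val q.2.
Proof. exact: (chart_circle_surj (set_valP q.1) (set_valP q.2)). Qed.

Definition triv_inv_val (q : (set_type U * S1)%type) : E :=
  sval (cid (triv_inv_ex q)).

Lemma triv_inv_base q : proj_base (triv_inv_val q) = set_val q.1.
Proof. by rewrite /triv_inv_val; case: cid => x []. Qed.

Lemma triv_inv_circle q : chart_circle i (triv_inv_val q) = set_val q.2.
Proof. by rewrite /triv_inv_val; case: cid => x []. Qed.

Lemma triv_inv_dom q : (proj_base @^-1` U) (triv_inv_val q).
Proof. by rewrite /= triv_inv_base; exact: set_valP. Qed.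

Definition trivialization_inv q : set_type (proj_base @^-1` U) := sub_elt (triv_inv_dom q).

Lemma trivializationK : cancel trivialization trivialization_inv.
Proof.
move=> x; apply: val_inj; rewrite /= -[RHS]/(set_val x).
apply: (@chart_circle_inj i).
- exact: triv_inv_dom.
- by rewrite triv_inv_base.
- by rewrite triv_inv_circle.
Qed.

Lemma trivialization_invK : cancel trivialization_inv trivialization.
Proof.
move=> [b c]; congr (_, _); apply: val_inj; rewrite /=.
  by rewrite -/(triv_inv_val (b, c)) /= triv_inv_base.
by rewrite triv_inv_circle.
Qed.

Lemma triv_continuous : continuous trivialization.
Proof.
have cE k l : continuous (fun x : set_type (proj_base @^-1` U) => (set_val (set_val x)).2 k l).
  by apply: projection_entry_continuous; exact: set_val_continuous.
move=> x; apply: continuous_at_pair.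
  move: x; apply: continuous_to_sub => x.
  apply: (@continuous_at_comp _ _ _ set_val proj_base); first exact: set_val_continuous.
  exact: proj_base_continuous.
move: x; apply: continuous_to_sub => x.
have [h [_ _ _ _ [n0 _ _]]] := chart_circle_spec (set_valP x).
apply: continuous_at_pair.
  apply: continuous_atM; first by apply: continuous_atB; exact: cE.
  by apply: continuous_atV => //; apply: continuous_atD; exact: cE.
apply: continuous_atM; first by apply: continuous_atM; [exact: continuous_at_cst|exact: cE].
by apply: continuous_atV => //; apply: continuous_atD; exact: cE.
Qed.

(** After clearing denominators, the graph is given by polynomial
equations in the projector, hence it is closed. *)
Lemma triv_inv_continuous : continuous trivialization_inv.
Proof.
apply: continuous_to_sub; apply: closed_graph_continuous.
  exact: bundle_space_compact.
pose T := ((set_type U * S1) * E)%type.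
have cb : continuous (fun z : T => set_val z.1.1).
  move=> z; apply: (@continuous_at_comp _ _ _ (fun z : T => z.1.1) set_val); last exact: set_val_continuous.
  by apply: (@continuous_at_comp _ _ _ fst fst); exact: continuous_fst.
have cc : continuous (fun z : T => set_val z.1.2).
  move=> z; apply: (@continuous_at_comp _ _ _ (fun z : T => z.1.2) set_val); last exact: set_val_continuous.
  by apply: (@continuous_at_comp _ _ _ fst snd); [exact: continuous_fst|exact: continuous_snd].
have c1 : continuous (fun z : T => (set_val z.1.2).1).
  by move=> z; apply: (@continuous_at_comp _ _ _ _ fst); [exact: cc|exact: continuous_fst].
have c2 : continuous (fun z : T => (set_val z.1.2).2).
  by move=> z; apply: (@continuous_at_comp _ _ _ _ snd); [exact: cc|exact: continuous_snd].
have cE k l : continuous (fun z : T => (set_val z.2).2 k l).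
  by apply: projection_entry_continuous; exact: continuous_snd.
have cp : continuous (fun z : T => proj_base z.2).
  move=> z; apply: (@continuous_at_comp _ _ _ snd proj_base); first exact: continuous_snd.
  exact: proj_base_continuous.
rewrite (_ : [set z | _] = [set z : T | proj_base z.2 = set_val z.1.1] `&`
  ([set z : T | (set_val z.1.2).1 * ((set_val z.2).2 ord0 ord0 + (set_val z.2).2 i i) =
     (set_val z.2).2 ord0 ord0 - (set_val z.2).2 i i] `&`
   [set z : T | (set_val z.1.2).2 * ((set_val z.2).2 ord0 ord0 + (set_val z.2).2 i i) =
     2 * (set_val z.2).2 ord0 i])).
  apply: closedI; first by apply: closed_equalizer => //; exact: base_hausdorff.
  apply: closedI; apply: closed_real_eq => z.
  - apply: continuous_atM; [exact: c1|apply: continuous_atD; exact: cE].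
  - by apply: continuous_atB; exact: cE.
  - apply: continuous_atM; [exact: c2|apply: continuous_atD; exact: cE].
  - by apply: continuous_atM; [exact: continuous_at_cst|exact: cE].
apply/seteqP; split=> -[[b c] x] /=.
  rewrite -[set_val _]/(triv_inv_val (b, c)) => ->.
  have xi := triv_inv_dom (b, c).
  have [h [_ _ _ _ [n0 _ _]]] := chart_circle_spec xi.
  have <- : chart_circle i (triv_inv_val (b, c)) = set_val c.
    by rewrite triv_inv_circle.
  by rewrite triv_inv_base /chart_circle /=; split=> //; rewrite !divfK.
rewrite -[set_val (trivialization_inv _)]/(triv_inv_val (b, c)).
move=> [xb [e1 e2]]; have xi : chart_domain i (proj_base x) by rewrite xb; exact: set_valP.
apply: (@chart_circle_inj i) => //; first by rewrite triv_inv_base.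
have [h [_ _ _ _ [n0 _ _]]] := chart_circle_spec xi.
rewrite triv_inv_circle /= [RHS]surjective_pairing /chart_circle -e1 -e2.
by rewrite !mulfK.
Qed.

End Trivialization.

Lemma proj_base_circle_bundle : circle_bundle R proj_base.
Proof.
split; first exact: proj_base_continuous.
move=> b; have [i bi] := chart_domain_cover b.
exists (chart_domain i); split=> //; first exact: chart_domain_open.
exists (@trivialization i); split; last by [].
split; first exact: triv_continuous.
exists (@trivialization_inv i); split; [exact: triv_inv_continuous|exact: trivializationK|exact: trivialization_invK].
Qed.

(** If F_k vanished at h + e h' for two values of e, it would vanish at h
and at h', which genericity excludes; so at most one value of e is bad. *)
Lemma near_nonvanishing b k h h' : fiber b h -> fiber b h' -> h != 0 ->
  (forall c, h' <> c *: h) ->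
  \forall e \near (0 : R)^', ~ vanishing k (h + e *: h').
Proof.
move=> fh fh' h0 nh'.
have [[e0 ve0]|none] := pselect (exists e, vanishing k (h + e *: h')); last first.
  by apply: nearW => e ve; apply: none; exists e.
have : \forall e \near (0 : R)^', e != e0.
  have [->|e00] := eqVneq e0 0; first exact: nbhs_dnbhs_neq.
  apply: nbhs_dnbhs; apply: open_nbhs_nbhs; split; last by rewrite /= eq_sym.
  rewrite (_ : (fun e => _) = ~` [set e0]); last first.
    by apply/seteqP; split=> e /= /eqP.
  apply: closed_openC; apply: accessible_closed_set1.
  exact: hausdorff_accessible (@Rhausdorff R).
apply: filterS => e ne ve.
have vh' : vanishing k h'.
  have [ax ay] := ve; have [bx byy] := ve0.
  rewrite -[h]scale1r !mul_row_lin !mul1r in ax ay bx byy.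
  have d0 : e - e0 != 0 by rewrite subr_eq0.
  split; apply: (mulfI d0); rewrite mulr0 mulrBl.
    by apply/eqP; rewrite subr_eq0; apply/eqP; apply: (addrI ((h *m X) 0 k)); rewrite ax bx.
  by apply/eqP; rewrite subr_eq0; apply/eqP; apply: (addrI ((h *m Y) 0 k)); rewrite ay byy.
have vh : vanishing k h.
  rewrite (_ : h = 1 *: (h + e *: h') + (- e) *: h'); last first.
    by rewrite scale1r scaleNr addrK.
  have [ax ay] := ve; have [cx cy] := vh'.
  by split; rewrite mul_row_lin ?ax ?ay ?cx ?cy !mulr0 addr0.
have [c ec] := generic fh fh' vh vh' h0.
exact: (nh' c).
Qed.

Lemma fiber_nonvanishing b : critical_direction b ->
  exists h, fiber b h /\ forall k, ~ vanishing k h.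
Proof.
move=> cb; have [h [h' [fh fh' h0 nh']]] := cb.
have nV : \forall e \near (0 : R)^', forall k, ~ vanishing k (h + e *: h').
  by apply: filter_forall => k; exact: near_nonvanishing nh'.
have [e Ve] := @filter_ex _ _ (Proper_dnbhs_numFieldType (0 : R)) _ nV.
by exists (h + e *: h'); split=> //; rewrite -[h]scale1r; exact: fiber_lin.
Qed.

Lemma sec_eq_vanishing i j (b : set_type B) h : sec i b = sec j b ->
  fiber (set_val b) h -> h != 0 -> vanishing i h -> vanishing j h.
Proof.
move=> eij fh h0 vi.
have tot : bundle_space (set_val b, projector h).
  by split=> /=; [exact: set_valP|exists h].
pose x : E := sub_elt tot.
have xb : proj_base x = b by apply: val_inj; rewrite /= set_valE.
have dx : on_divisor i x.
  by move=> l; rewrite set_valE; exact: (iffRL (projector_vanishing i h0) vi l).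
apply/(projector_vanishing j h0) => l.
have : on_divisor j x by rewrite -(sec_eq dx) xb eij; exact: sec_on_divisor.
by move=> /(_ l); rewrite set_valE.
Qed.

(** In the direction of a second vector h' of W_b, the points h + e h' with e
small and nonzero avoid the five divisors. *)
Lemma off_divisors_dense : dense [set x : E | forall k, ~ on_divisor k x].
Proof.
move=> U [x Ux] oU.
have [cb [h [h0 fh eh]]] := set_valP x.
have [h' fh' nh'] := critical_independent h cb.
have n0 e : h + e *: h' != 0.
  apply/eqP => /eqP; rewrite addr_eq0 => /eqP he.
  have e0 : e != 0.
    by apply: contraNneq h0 => e0; rewrite he e0 scale0r oppr0.
  by apply: (nh' (- e^-1)); rewrite he scalerN scaleNr opprK scalerA mulVf// scale1r.
have tot e : bundle_space ((set_val x).1, projector (h + e *: h')).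
  split=> //=; exists (h + e *: h'); split=> //.
  by rewrite -[h]scale1r; apply: fiber_lin.
pose g (e : R) : E := sub_elt (tot e).
have gx : g 0 = x.
  apply: val_inj; rewrite /= scale0r addr0 -eh -surjective_pairing.
  by rewrite set_valE.
have cg : continuous g.
  apply: continuous_to_sub.
  suff : continuous (fun e : R => ((set_val x).1, projector (h + e *: h'))) by [].
  move=> e; apply: continuous_at_pair; first exact: cst_continuous.
  apply: projector_continuous_at => //.
  apply: continuous_at_mx => i j.
  apply: (@continuous_at_ext R R (fun e : R => h i j + e * h' i j)); last by move=> t; rewrite !mxE.
  apply: continuous_atD; first exact: continuous_at_cst.
  by apply: continuous_atM; [exact: cvg_id|exact: continuous_at_cst].
have nU : \forall e \near (0 : R)^', U (g e).
  apply: nbhs_dnbhs; apply: (cg 0 U); apply: open_nbhs_nbhs.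
  by split=> //; rewrite gx.
have nV : \forall e \near (0 : R)^', forall k, ~ vanishing k (h + e *: h').
  by apply: filter_forall => k; exact: near_nonvanishing nh'.
have [e [Ue Ve]] :=
  @filter_ex _ _ (Proper_dnbhs_numFieldType (0 : R)) _ (filterI nU nV).
exists (g e); split=> // k; rewrite /on_divisor set_valE /=.
by move/(projector_vanishing k (n0 e)); exact: Ve.
Qed.

End Bundle.

(** * Cross products and cross-ratios *)

Section Vectors3.
Variable F : fieldType.

Record vec3 := Vec3 { v0 : F; v1 : F; v2 : F }.
Implicit Types (u v w x y : vec3).

Definition pairing u v : F := v0 u * v0 v + v1 u * v1 v + v2 u * v2 v.

Definition cross u v : vec3 :=
  Vec3 (v1 u * v2 v - v2 u * v1 v) (v2 u * v0 v - v0 u * v2 v)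
       (v0 u * v1 v - v1 u * v0 v).

Definition scale3 (c : F) u := Vec3 (c * v0 u) (c * v1 u) (c * v2 u).

Definition det3 u v w := pairing u (cross v w).

Definition zero3 := Vec3 0 0 0.

Lemma vec3_eq u v : v0 u = v0 v -> v1 u = v1 v -> v2 u = v2 v -> u = v.
Proof. by case: u v => ? ? ? [? ? ?] /= -> -> ->. Qed.

Lemma vec3_neq0 u : u <> zero3 -> [\/ v0 u != 0, v1 u != 0 | v2 u != 0].
Proof.
move=> u0; have [e0|] := eqVneq (v0 u) 0; last by constructor 1.
have [e1|] := eqVneq (v1 u) 0; last by constructor 2.
have [e2|] := eqVneq (v2 u) 0; last by constructor 3.
by case: u0; apply: vec3_eq.
Qed.

(** The hypothesis says that all 2 x 2 minors of the pair (u, v) vanish. *)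
Lemma cross_eq0 u v : u <> zero3 -> cross u v = zero3 ->
  exists c, v = scale3 c u.
Proof.
move=> /vec3_neq0 u0 [/eqP + /eqP + /eqP]; rewrite !subr_eq0.
move=> /eqP e0 /eqP e1 /eqP e2; case: u0 => n0.
- exists (v0 v / v0 u); apply: vec3_eq => /=; apply: (mulfI n0).
  + by field.
  + by rewrite e2; field.
  + by rewrite -e1; field.
- exists (v1 v / v1 u); apply: vec3_eq => /=; apply: (mulfI n0).
  + by rewrite -e2; field.
  + by field.
  + by rewrite e0; field.
- exists (v2 v / v2 u); apply: vec3_eq => /=; apply: (mulfI n0).
  + by rewrite e1; field.
  + by rewrite -e0; field.
  + by field.
Qed.

(** The cross product of u x v with n is v (u.n) - u (v.n) up to sign, hence 0. *)
Lemma cross_of_orthogonal u v n : n <> zero3 ->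
  pairing u n = 0 -> pairing v n = 0 -> exists c, cross u v = scale3 c n.
Proof.
move=> n0 un vn; apply: cross_eq0 => //.
rewrite /pairing in un vn; apply: vec3_eq => /=.
- transitivity (v0 u * (v0 v * v0 n + v1 v * v1 n + v2 v * v2 n) - v0 v * (v0 u * v0 n + v1 u * v1 n + v2 u * v2 n)); first by ring.
  by rewrite un vn !mulr0 subrr.
- transitivity (v1 u * (v0 v * v0 n + v1 v * v1 n + v2 v * v2 n) - v1 v * (v0 u * v0 n + v1 u * v1 n + v2 u * v2 n)); first by ring.
  by rewrite un vn !mulr0 subrr.
- transitivity (v2 u * (v0 v * v0 n + v1 v * v1 n + v2 v * v2 n) - v2 v * (v0 u * v0 n + v1 u * v1 n + v2 u * v2 n)); first by ring.
  by rewrite un vn !mulr0 subrr.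
Qed.

(** Cramer's rule. *)
Lemma det3_nondegenerate u v w x : det3 u v w != 0 ->
  pairing x u = 0 -> pairing x v = 0 -> pairing x w = 0 -> x = zero3.
Proof.
move=> d0 xu xv xw.
apply: vec3_eq; apply: (mulIf d0); rewrite mul0r.
- transitivity (pairing x u * v0 (cross v w) + pairing x v * v0 (cross w u) + pairing x w * v0 (cross u v)).
    by rewrite /det3 /pairing /cross /=; ring.
  by rewrite xu xv xw !mul0r !addr0.
- transitivity (pairing x u * v1 (cross v w) + pairing x v * v1 (cross w u) + pairing x w * v1 (cross u v)).
    by rewrite /det3 /pairing /cross /=; ring.
  by rewrite xu xv xw !mul0r !addr0.
- transitivity (pairing x u * v2 (cross v w) + pairing x v * v2 (cross w u) + pairing x w * v2 (cross u v)).
    by rewrite /det3 /pairing /cross /=; ring.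
  by rewrite xu xv xw !mul0r !addr0.
Qed.

(** The Binet-Cauchy identity; it turns 2 x 2 minors of the values of linear
forms at u and v into 3 x 3 minors of the forms. *)
Lemma binet_cauchy u v x y :
  pairing u x * pairing v y - pairing v x * pairing u y =
  pairing (cross u v) (cross x y).
Proof. by rewrite /pairing /cross /=; ring. Qed.

Lemma plucker u a b c d :
  det3 u a b * det3 u c d - det3 u a c * det3 u b d + det3 u a d * det3 u b c = 0.
Proof. by rewrite /det3 /pairing /cross /=; ring. Qed.

Lemma det3C23 u v w : det3 u w v = - det3 u v w.
Proof. by rewrite /det3 /pairing /cross /=; ring. Qed.

Lemma pairingZl c u v : pairing (scale3 c u) v = c * pairing u v.
Proof. by rewrite /pairing /=; ring. Qed.

Lemma pairing_cross1 u v : pairing (cross u v) u = 0.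
Proof. by rewrite /pairing /=; ring. Qed.

Lemma pairing_cross2 u v : pairing (cross u v) v = 0.
Proof. by rewrite /pairing /=; ring. Qed.

Lemma pairing_cross u v w : pairing (cross u v) w = det3 u v w.
Proof. by rewrite /det3 /pairing /=; ring. Qed.

End Vectors3.

Section CrossRatio.
Variable R : realType.
Local Notation C := R[i].
Local Open Scope complex_scope.
Implicit Types (u v w a b c d n : vec3 C).

(** The cross-ratio of the four points cut on the line n by the lines a, b, c, d,
multiplied by the square of the modulus of its denominator: it is real iff the
cross-ratio is, and it is polynomial in the coefficients and their conjugates. *)
Definition cross_ratio_num n a b c d : C :=
  det3 n a b * det3 n c d * conjc (det3 n a c * det3 n b d).

Lemma conjc_Im0 (z : C) : conjc z = z -> complex.Im z = 0.
Proof.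
case: z => x y [] /eqP; rewrite -subr_eq0 -opprD oppr_eq0 -mulr2n mulrn_eq0.
by move/eqP.
Qed.

Definition real_span (l : C) (z : C) := exists s : R, z = s%:C * l.

Lemma real_plane_minor (la lb xa ya xb yb : C) :
  real_span la xa -> real_span la ya -> real_span lb xb -> real_span lb yb ->
  exists r : R, xa * yb - ya * xb = r%:C * (la * lb).
Proof.
move=> [s ->] [t ->] [s' ->] [t' ->]; exists (s * t' - t * s').
by rewrite rmorphB !rmorphM /=; ring.
Qed.

(** All values of the forms a, b, c, d at u and v are real up to phases la, lb, lc
and ld. If u x v = k n with k nonzero, each minor [n x y] is lx ly / k times a
real number, and the phases cancel in the cross-ratio. *)
Lemma real_plane_cross_ratio n a b c d u v (la lb lc ld : C) :
  n <> zero3 C -> pairing u n = 0 -> pairing v n = 0 ->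
  real_span la (pairing u a) -> real_span la (pairing v a) ->
  real_span lb (pairing u b) -> real_span lb (pairing v b) ->
  real_span lc (pairing u c) -> real_span lc (pairing v c) ->
  real_span ld (pairing u d) -> real_span ld (pairing v d) ->
  complex.Im (cross_ratio_num n a b c d) != 0 ->
  cross u v = zero3 C.
Proof.
move=> n0 un vn ua va ub vb uc vc ud vd nreal.
have [k ek] := cross_of_orthogonal n0 un vn.
have [k0|k0] := eqVneq k 0.
  by rewrite ek k0 /scale3 !mul0r.
have M x y lx ly : real_span lx (pairing u x) -> real_span lx (pairing v x) ->
    real_span ly (pairing u y) -> real_span ly (pairing v y) ->
    exists r : R, det3 n x y = r%:C * (lx * ly) / k.
  move=> ux vx uy vy; have [r er] := real_plane_minor ux vx uy vy.
  exists r; rewrite -er binet_cauchy ek pairingZl -/(det3 n x y).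
  by rewrite mulrAC divff// mul1r.
have [r1 e1] := M _ _ _ _ ua va ub vb.
have [r2 e2] := M _ _ _ _ uc vc ud vd.
have [r3 e3] := M _ _ _ _ ua va uc vc.
have [r4 e4] := M _ _ _ _ ub vb ud vd.
case/negP: nreal; apply/eqP; apply: conjc_Im0; rewrite /cross_ratio_num.
have cM (x y : C) : conjc (x * y) = conjc x * conjc y by rewrite rmorphM.
rewrite e1 e2 e3 e4 !cM !conjc_inv !conjc_real !conjcK.
set ik := k^-1; set jk := (conjc k)^-1.
ring.
Qed.

End CrossRatio.

(** * Affine planes as families of real linear forms *)

Section FrameForms.
Variable R : realType.
Local Notation C := R[i].
Implicit Types (p : 'rV[Cplx R]_4) (M : 'M[Cplx R]_(2, 4)) (h : 'rV[R]_5)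
  (u : 'rV[R]_(2 + 2)) (k : 'I_5).

(** The coefficients of the form F_k; as linear forms on C^3 they define the line
at infinity and the four coordinate lines of the plane. *)
Definition coframe p M k : vec3 C :=
  if unlift ord0 k is Some j then Vec3 (p 0 j : C) (M 0 j) (M 1 j)
  else Vec3 1 0 0.

Definition homog (t : R) u : 'rV[R]_5 :=
  \row_i (if unlift ord0 i is Some l then u 0 (l : 'I_(2 + 2)) else t).

Definition affine_part h : 'rV[R]_(2 + 2) := \row_l h 0 (lift ord0 (l : 'I_4)).

(** R^5 = R x C^2 inside C^3. *)
Definition hvec h : vec3 C :=
  Vec3 (Complex (h 0 ord0) 0) (complexify (affine_part h) 0 0 : C)
       (complexify (affine_part h) 0 1).

(** The value F_k(h). *)
Definition hform p M h k : C := pairing (hvec h) (coframe p M k).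

Definition re_forms p M : 'M[R]_5 :=
  \matrix_(i, k) complex.Re (hform p M (delta_mx 0 i) k).
Definition im_forms p M : 'M[R]_5 :=
  \matrix_(i, k) complex.Im (hform p M (delta_mx 0 i) k).

Lemma homogK h : homog (h 0 ord0) (affine_part h) = h.
Proof.
apply/rowP => i; rewrite mxE; case: unliftP => [l ->|->] //.
by rewrite mxE.
Qed.

Lemma homog0 t u : homog t u 0 ord0 = t.
Proof. by rewrite mxE unlift_none. Qed.

Lemma affine_part_homog t u : affine_part (homog t u) = u.
Proof. by apply/rowP => l; rewrite !mxE liftK. Qed.

Lemma complexify_lin (a : R) u u' (k : 'I_2) :
  (complexify (a *: u + u') 0 k : C) =
  Complex a 0 * (complexify u 0 k : C) + (complexify u' 0 k : C).
Proof.
by rewrite !mxE /=; apply/eqP; rewrite eq_complex /= !mul0r subr0 addr0 !eqxx.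
Qed.

Lemma affine_part_lin (a : R) h h' :
  affine_part (a *: h + h') = a *: affine_part h + affine_part h'.
Proof. by apply/rowP => l; rewrite !mxE. Qed.

Lemma hform_lin p M (a : R) h h' k :
  hform p M (a *: h + h') k = Complex a 0 * hform p M h k + hform p M h' k.
Proof.
rewrite /hform /pairing /hvec /= affine_part_lin !complexify_lin.
have -> : Complex ((a *: h + h') 0 ord0) 0 =
    Complex a 0 * Complex (h 0 ord0) 0 + Complex (h' 0 ord0) 0 :> C.
  by rewrite !mxE; apply/eqP; rewrite eq_complex /= !mulr0 !mul0r !addr0 subr0 !eqxx.
by ring.
Qed.

Lemma hformD p M h h' k : hform p M (h + h') k = hform p M h k + hform p M h' k.
Proof. by have := hform_lin p M 1 h h' k; rewrite scale1r => ->; rewrite mul1r. Qed.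

Lemma hform0 p M k : hform p M 0 k = 0.
Proof. by apply: (addrI (hform p M 0 k)); rewrite -hformD !addr0. Qed.

Lemma hformZ p M (a : R) h k : hform p M (a *: h) k = Complex a 0 * hform p M h k.
Proof. by rewrite -[a *: h]addr0 hform_lin hform0 addr0. Qed.

Lemma hform_sum p M h k :
  hform p M h k = \sum_i Complex (h 0 i) 0 * hform p M (delta_mx 0 i) k.
Proof.
rewrite [in LHS](row_sum_delta h).
rewrite (big_morph (fun h => hform p M h k) (fun x y => hformD p M x y k) (hform0 p M k)).
by apply: eq_bigr => i _; rewrite hformZ.
Qed.

Lemma re_formsE p M h k : (h *m re_forms p M) 0 k = complex.Re (hform p M h k).
Proof.
rewrite hform_sum mxE (big_morph _ (raddfD (@complex.Re R)) (raddf0 (@complex.Re R))).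
by apply: eq_bigr => i _; rewrite mxE; case: (hform _ _ _ _) => x y /=; rewrite mul0r subr0.
Qed.

Lemma im_formsE p M h k : (h *m im_forms p M) 0 k = complex.Im (hform p M h k).
Proof.
rewrite hform_sum mxE (big_morph _ (raddfD (@complex.Im R)) (raddf0 (@complex.Im R))).
by apply: eq_bigr => i _; rewrite mxE; case: (hform _ _ _ _) => x y /=; rewrite mul0r addr0.
Qed.

Lemma hform_ord0 p M h : hform p M h ord0 = Complex (h 0 ord0) 0.
Proof. by rewrite /hform /pairing /coframe unlift_none /= !mulr0 !addr0 mulr1. Qed.

Lemma re_forms0 p M h : (h *m re_forms p M) 0 ord0 = h 0 ord0.
Proof. by rewrite re_formsE hform_ord0. Qed.

Lemma im_forms0 p M h : (h *m im_forms p M) 0 ord0 = 0.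
Proof. by rewrite im_formsE hform_ord0. Qed.

Lemma hform_lift p M t u j : hform p M (homog t u) (lift ord0 j) =
  Complex t 0 * (p 0 j : C) + ((complexify u *m M) 0 j : C).
Proof.
rewrite /hform /pairing /coframe liftK /= affine_part_homog homog0 -addrA; congr (_ + _).
by rewrite [RHS]mxE !big_ord_recl big_ord0 addr0 (_ : lift ord0 ord0 = 1)//; exact: val_inj.
Qed.

Lemma hform_aff p M u j :
  hform p M (homog 1 u) (lift ord0 j) = aff p M (complexify u) 0 j.
Proof. by rewrite hform_lift mul1r /aff [RHS]mxE. Qed.

Lemma complexify_inj u u' : complexify u = complexify u' -> u = u'.
Proof.
move=> e; rewrite -(hsubmxK u) -(hsubmxK u'); congr row_mx; apply/rowP => k.
  by have /rowP/(_ k) := e; rewrite !mxE => -[].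
by have /rowP/(_ k) := e; rewrite !mxE => -[].
Qed.

Lemma hvec_inj h h' : hvec h = hvec h' -> h = h'.
Proof.
rewrite /hvec => -[e0 e1 e2]; rewrite -(homogK h) -(homogK h') e0.
rewrite (_ : affine_part h = affine_part h') //.
apply: complexify_inj; apply/rowP => k.
have [->|k0] := eqVneq k 0; first exact: e1.
by rewrite (_ : k = 1)//; apply: val_inj; case: k k0 => [[|[|//]] ?].
Qed.

Lemma hvec_eq0 h : hvec h = zero3 C -> h = 0.
Proof.
move=> e; apply: hvec_inj; rewrite e.
have z (k : 'I_2) : (complexify (affine_part 0) 0 k : C) = 0.
  by rewrite mxE; apply/eqP; rewrite eq_complex /= !mxE eqxx.
by apply: vec3_eq; rewrite /= ?z// mxE.
Qed.

Definition frame_cross_ratio p M k : C :=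
  cross_ratio_num (coframe p M k)
    (coframe p M (lift k (inord 0))) (coframe p M (lift k (inord 1)))
    (coframe p M (lift k (inord 2))) (coframe p M (lift k (inord 3))).

Definition generic_frame p M : Prop :=
  forall k, complex.Im (frame_cross_ratio p M k) != 0.

Lemma line_real_span (b : RP1 R) (z : C) :
  on_line b (complex.Re z) (complex.Im z) ->
  real_span (Complex (hrepr b).1 (hrepr b).2) z.
Proof.
case/on_lineP => r [e1 e2]; exists r; rewrite [LHS]complexE e1 e2.
by apply/eqP; rewrite eq_complex /=; apply/andP; split; apply/eqP; ring.
Qed.

Lemma complex_eq0 (z : C) : complex.Re z = 0 -> complex.Im z = 0 -> z = 0.
Proof. by case: z => x y /= -> ->. Qed.

(** A vanishing minor forces the cross-ratio to be 0 or infinite, or, by the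
Pluecker relation, to be 1. *)
Lemma cross_ratio_num_minors n a b c d :
  complex.Im (@cross_ratio_num R n a b c d) != 0 ->
  [/\ det3 n a b != 0, det3 n c d != 0, det3 n a c != 0, det3 n b d != 0 &
      det3 n a d != 0 /\ det3 n b c != 0].
Proof.
rewrite /cross_ratio_num => q.
have ab : det3 n a b != 0 by apply: contraNneq q => ->; rewrite !mul0r.
have cd : det3 n c d != 0 by apply: contraNneq q => ->; rewrite mulr0 mul0r.
have ac : det3 n a c != 0 by apply: contraNneq q => ->; rewrite mul0r conjc0 mulr0.
have bd : det3 n b d != 0 by apply: contraNneq q => ->; rewrite mulr0 conjc0 mulr0.
have : det3 n a d * det3 n b c != 0.
  apply: contraNneq q => e.
  have := plucker n a b c d; rewrite e addr0 => /eqP; rewrite subr_eq0 => /eqP ->.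
  have Im0 (z : C) : complex.Im (z * conjc z) = 0 by case: z => x y /=; ring.
  by rewrite Im0.
by rewrite mulf_eq0 negb_or => /andP[].
Qed.

Lemma generic_frame_minors p M : generic_frame p M ->
  forall k a b : 'I_5, a != k -> b != k -> a != b ->
  det3 (coframe p M k) (coframe p M a) (coframe p M b) != 0.
Proof.
move=> gen k a b.
case: (unliftP k a) => [a' -> _|->]; last by rewrite eqxx.
case: (unliftP k b) => [b' -> _|->]; last by rewrite eqxx.
rewrite (inj_eq lift_inj) => ab.
have [m01 m23 m02 m13 [m03 m12]] := cross_ratio_num_minors (gen k).
have pairs (P : nat -> nat -> Prop) : (forall i j, P i j -> P j i) ->
    P 0 1 -> P 2 3 -> P 0 2 -> P 1 3 -> P 0 3 -> P 1 2 ->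
    forall i j, (i < 4)%N -> (j < 4)%N -> i != j -> P i j.
  by move=> sym ? ? ? ? ? ? [|[|[|[|//]]]] [|[|[|[|//]]]] _ _ // _; exact: sym.
pose P i j := det3 (coframe p M k) (coframe p M (lift k (inord i)))
                   (coframe p M (lift k (inord j))) != 0.
have symP i j : P i j -> P j i by rewrite /P det3C23 oppr_eq0.
have := pairs P symP m01 m23 m02 m13 m03 m12 a' b' (ltn_ord a') (ltn_ord b') ab.
by rewrite /P !inord_val.
Qed.

(** By [real_plane_cross_ratio] the two vectors are proportional over C. The ratio
is real because some F_i is nonzero at h, and F_i(h), F_i(h') lie on one real
line. *)
Lemma generic_frame_fiber p M : generic_frame p M -> forall b k h h',
  fiber (re_forms p M) (im_forms p M) b h ->
  fiber (re_forms p M) (im_forms p M) b h' ->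
  vanishing (re_forms p M) (im_forms p M) k h ->
  vanishing (re_forms p M) (im_forms p M) k h' ->
  h != 0 -> exists c, h' = c *: h.
Proof.
move=> gen b k h h' fh fh' [vx vy] [vx' vy'] h0.
rewrite re_formsE in vx; rewrite re_formsE in vx'.
rewrite im_formsE in vy; rewrite im_formsE in vy'.
have rs g i : fiber (re_forms p M) (im_forms p M) b g -> real_span
    (Complex (hrepr (line_at b i)).1 (hrepr (line_at b i)).2) (hform p M g i).
  by move=> fg; apply: line_real_span; have := fg i; rewrite re_formsE im_formsE.
have [m01 _ _ _ _] := cross_ratio_num_minors (gen k).
have n0 : coframe p M k <> zero3 C.
  move=> e; move: m01; rewrite e /det3 /pairing /= !mul0r !addr0.
  by rewrite eqxx.
have kh := complex_eq0 vx vy; have kh' := complex_eq0 vx' vy'.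
have cr := real_plane_cross_ratio n0 kh kh' (rs _ _ fh) (rs _ _ fh') (rs _ _ fh)
  (rs _ _ fh') (rs _ _ fh) (rs _ _ fh') (rs _ _ fh) (rs _ _ fh') (gen k).
have hv0 : hvec h <> zero3 C by move=> /hvec_eq0 /eqP; rewrite (negbTE h0).
have [c ec] := cross_eq0 hv0 cr.
have [i hi] : exists i, hform p M h i != 0.
  apply: contrapT => H; apply: hv0; apply: (det3_nondegenerate m01) => //.
    by apply: contrapT => /eqP ne; apply: H; exists (lift k (inord 0)).
  by apply: contrapT => /eqP ne; apply: H; exists (lift k (inord 1)).
have [s es] := rs _ i fh; have [t et] := rs _ i fh'.
have ci : hform p M h' i = c * hform p M h i by rewrite /hform ec pairingZl.
have s0 : s != 0 by apply: contraNneq hi => s0; rewrite es s0 mul0r.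
exists (t / s); apply: hvec_inj; rewrite ec.
have -> : c = Complex (t / s) 0.
  apply: (mulIf hi); rewrite -ci et es mulrA; congr (_ * _).
  by apply/eqP; rewrite eq_complex /= !mul0r !mulr0 addr0 subr0 divfK// !eqxx.
have := complexify_lin (t / s) (affine_part h) 0.
have z (k' : 'I_2) : (complexify 0 0 k' : C) = 0.
  by rewrite mxE; apply/eqP; rewrite eq_complex /= !mxE eqxx.
move=> cl; apply: vec3_eq => /=.
- by rewrite mxE; apply/eqP; rewrite eq_complex /= !mulr0 !mul0r subr0 addr0 !eqxx.
- have := affine_part_lin (t / s) h 0; rewrite addr0 => ->.
  rewrite (_ : affine_part 0 = 0) ?cl ?z ?addr0//.
  by apply/rowP => l; rewrite !mxE.
- have := affine_part_lin (t / s) h 0; rewrite addr0 => ->.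
  rewrite (_ : affine_part 0 = 0) ?cl ?z ?addr0//.
  by apply/rowP => l; rewrite !mxE.
Qed.

End FrameForms.

(** * Lines through two double points *)

Section Separation.
Variable R : realType.
Local Notation C := R[i].
Implicit Types (p : 'rV[Cplx R]_4) (M : 'M[Cplx R]_(2, 4)).

Lemma hvec_surj (w : vec3 C) : complex.Im (v0 w) = 0 -> exists h, hvec h = w.
Proof.
case: w => w0 w1 w2 /= im0.
pose f (k : 'I_2) := if k == 0 then w1 else w2.
exists (homog (complex.Re w0)
  (row_mx (\row_k complex.Re (f k)) (\row_k complex.Im (f k)))).
have cE (k : 'I_2) : (complexify (row_mx (\row_k complex.Re (f k)) (\row_k complex.Im (f k))) 0 k : C) = f k.
  by rewrite /complexify row_mxKl row_mxKr !mxE; case: (f k).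
rewrite /hvec affine_part_homog homog0; apply: vec3_eq; rewrite /= ?cE//.
by case: w0 im0 => x y /= ->.
Qed.

Lemma vanishing_hform p M h k :
  vanishing (re_forms p M) (im_forms p M) k h <-> hform p M h k = 0.
Proof.
rewrite /vanishing /= re_formsE im_formsE.
split=> [[]|->] //; exact: complex_eq0.
Qed.

Lemma fiber_hform p M b h :
  (forall j, on_line (b j) (complex.Re (hform p M h (lift ord0 j)))
                           (complex.Im (hform p M h (lift ord0 j)))) <->
  fiber (re_forms p M) (im_forms p M) b h.
Proof.
split=> [H k|H j]; last first.
  by have := H (lift ord0 j); rewrite /line_at liftK re_formsE im_formsE.
rewrite /line_at re_formsE im_formsE; case: unliftP => [j ->|->]; first exact: H.
rewrite hform_ord0 /=; apply/on_line_hcoord; first by rewrite pair_neq0 oner_eq0.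
by rewrite mulr0 mul0r.
Qed.

Lemma complex_pair_neq0 (z : C) : z != 0 ->
  (complex.Re z, complex.Im z) != 0 :> R * R.
Proof.
by move=> /eqP z0; apply/eqP => -[x0 y0]; apply: z0; exact: complex_eq0.
Qed.

(** W is spanned by a representative wA of the point F_0 = F_c = 0 and a
representative wB of the point F_k = F_d = 0. They can be scaled so that
F_0(wB) = 1 and F_e(wA) = F_e(wB); then each F_i takes values on a real line
on W. *)
Lemma separated_pencil p M (c k d e : 'I_5) : generic_frame p M ->
  uniq [:: ord0; c; k; d; e] -> (forall i, i \in [:: ord0; c; k; d; e]) ->
  exists b h h', [/\ critical_direction (re_forms p M) (im_forms p M) b,
    [/\ h != 0, fiber (re_forms p M) (im_forms p M) b h &
      forall i, vanishing (re_forms p M) (im_forms p M) i h <->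
                i \in [:: ord0; c]] &
    [/\ h' != 0, fiber (re_forms p M) (im_forms p M) b h' &
      forall i, vanishing (re_forms p M) (im_forms p M) i h' <->
                i \in [:: k; d]]].
Proof.
move=> gen un all5.
pose N := coframe p M.
have D x y z : x != y -> x != z -> y != z -> det3 (N x) (N y) (N z) != 0.
  by move=> xy xz yz; apply: generic_frame_minors; rewrite // eq_sym.
move: un => /=; rewrite !inE !negb_or -!andbA.
case/and5P => zc zk zd ze /and5P [ck cd ce kd /and3P [ke de _]].
(* The normalizing factors of wB and wA: be makes F_0(wB) = 1, and then al
   makes F_e(wA) = F_e(wB). *)
pose be : C := (det3 (N k) (N d) (N ord0))^-1.
pose al : C := be * det3 (N k) (N d) (N e) / det3 (N ord0) (N c) (N e).
pose wA := scale3 al (cross (N ord0) (N c)).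
pose wB := scale3 be (cross (N k) (N d)).
have be0 : be != 0 by rewrite invr_eq0 D// eq_sym.
have al0 : al != 0.
  apply: mulf_neq0; last by rewrite invr_eq0 D.
  by apply: mulf_neq0; last exact: D.
have N0 w : pairing w (N ord0) = v0 w.
  by rewrite /N /coframe unlift_none /pairing /= mulr1 !mulr0 !addr0.
have eA x : pairing wA (N x) = al * det3 (N ord0) (N c) (N x).
  by rewrite pairingZl pairing_cross.
have eB x : pairing wB (N x) = be * det3 (N k) (N d) (N x).
  by rewrite pairingZl pairing_cross.
have A0 : pairing wA (N ord0) = 0 by rewrite pairingZl pairing_cross1 mulr0.
have Ac : pairing wA (N c) = 0 by rewrite pairingZl pairing_cross2 mulr0.
have Bk : pairing wB (N k) = 0 by rewrite pairingZl pairing_cross1 mulr0.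
have Bd : pairing wB (N d) = 0 by rewrite pairingZl pairing_cross2 mulr0.
have B0 : pairing wB (N ord0) = 1 by rewrite eB mulVf// D// eq_sym.
have Bc : pairing wB (N c) != 0 by rewrite eB mulf_neq0// D// eq_sym.
have Ak : pairing wA (N k) != 0 by rewrite eA mulf_neq0// D.
have Ad : pairing wA (N d) != 0 by rewrite eA mulf_neq0// D.
have Be : pairing wB (N e) != 0 by rewrite eB mulf_neq0// D.
have Ae : pairing wA (N e) = pairing wB (N e) by rewrite eA eB /al divfK// D.
have [h hE] : exists h, hvec h = wA by apply: hvec_surj; rewrite -N0 A0.
have [h' h'E] : exists h, hvec h = wB by apply: hvec_surj; rewrite -N0 B0.
have fA x : hform p M h x = pairing wA (N x) by rewrite /hform hE.
have fB x : hform p M h' x = pairing wB (N x) by rewrite /hform h'E.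
(* The line of index j is spanned by the value of F_j at wA + wB, which is
   never 0. *)
pose z j := hform p M h (lift ord0 j) + hform p M h' (lift ord0 j).
pose b : RP1_4 R := fun j => hcoord (complex.Re (z j)) (complex.Im (z j)).
have real_mult (s : R) (x : C) : x != 0 ->
    on_line (hcoord (complex.Re x) (complex.Im x)) (complex.Re (Complex s 0 * x)) (complex.Im (Complex s 0 * x)).
  move=> x0; apply/on_line_hcoord; first exact: complex_pair_neq0.
  by case: (x) => x1 x2 /=; ring.
have cases i : [\/ hform p M h i = 0 /\ hform p M h' i != 0,
    hform p M h i != 0 /\ hform p M h' i = 0 |
    hform p M h i = hform p M h' i /\ hform p M h' i != 0].
  rewrite !fA !fB; have := all5 i; rewrite !inE => /or4P [/eqP->|/eqP->|/eqP->|/orP[]/eqP->].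
  - by constructor 1; rewrite A0 B0 oner_eq0.
  - by constructor 1.
  - by constructor 2.
  - by constructor 2.
  - by constructor 3.
have mult j : exists s s', [/\ z j != 0,
    hform p M h (lift ord0 j) = Complex s 0 * z j &
    hform p M h' (lift ord0 j) = Complex s' 0 * z j].
  have one : Complex 1 0 = 1 :> C by [].
  have zero : Complex 0 0 = 0 :> C by [].
  rewrite /z; case: (cases (lift ord0 j)) => -[e1 n0].
  - by exists 0, 1; rewrite e1 add0r one zero mul1r mul0r.
  - by exists 1, 0; rewrite n0 addr0 one zero mul1r mul0r.
  (* F_e takes equal values at wA and wB, and z is their sum *)
  - exists (2^-1), (2^-1); rewrite e1 -mulr2n mulrn_eq0 n0 /=.
    have -> : Complex (2^-1 : R) 0 * (hform p M h' (lift ord0 j) *+ 2) = hform p M h' (lift ord0 j).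
      by case: (hform _ _ _ _) => x y; apply/eqP; rewrite eq_complex /=; apply/andP; split; apply/eqP; field.
    by [].
have fh : fiber (re_forms p M) (im_forms p M) b h.
  apply/fiber_hform => j; have [s [s' [n0 -> _]]] := mult j; exact: real_mult.
have fh' : fiber (re_forms p M) (im_forms p M) b h'.
  apply/fiber_hform => j; have [s [s' [n0 _ ->]]] := mult j; exact: real_mult.
have h0 : h != 0 by apply: contraNneq Ak => h0; rewrite -fA h0 hform0.
have h'0 : h' != 0 by apply: contraNneq Bc => h0'; rewrite -fB h0' hform0.
exists b, h, h'; split.
- exists h, h'; split=> // r e1; have := fB ord0.
  by rewrite e1 hformZ fA A0 mulr0 B0 => /esym/eqP; rewrite oner_eq0.
- split=> // i; split=> [/vanishing_hform|iA]; last first.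
    apply/vanishing_hform; rewrite fA.
    by move: iA; rewrite !inE => /orP[] /eqP ->.
  rewrite fA => vi; have := all5 i; rewrite !inE => /or4P[->|->|/eqP i1|/orP[]/eqP i1]//.
  - by rewrite orbT.
  - by move: Ak; rewrite -i1 vi eqxx.
  - by move: Ad; rewrite -i1 vi eqxx.
  - by move: Be; rewrite -Ae -i1 vi eqxx.
- split=> // i; split=> [/vanishing_hform|iA]; last first.
    apply/vanishing_hform; rewrite fB.
    by move: iA; rewrite !inE => /orP[] /eqP ->.
  rewrite fB => vi; have := all5 i; rewrite !inE => /or4P[/eqP i1|/eqP i1|->|/orP[->|/eqP i1]]//.
  - by move/eqP: vi; rewrite i1 B0 oner_eq0.
  - by move: Bc; rewrite -i1 vi eqxx.
  - by rewrite orbT.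
  - by move: Be; rewrite -i1 vi eqxx.
Qed.

End Separation.

(** * Genericity is a real-algebraic condition *)

Section Genericity.
Variable R : realType.
Local Notation C := R[i].
Implicit Types (p : 'rV[Cplx R]_4) (M : 'M[Cplx R]_(2, 4)).

Lemma affine_frame_change V p M p' M' :
  affine_frame V p M -> affine_frame V p' M' ->
  exists (w : 'rV[Cplx R]_2) (A : 'M[Cplx R]_2),
    [/\ A \in unitmx, p' = p + w *m M & M' = A *m M].
Proof.
move=> [fM VM] [fM' VM'].
have inV w : exists w', aff p' M' w = aff p M w'.
  have : V (aff p' M' w) by rewrite VM'; exists w.
  by rewrite VM => -[w' _ <-]; exists w'.
have [w0 e0] := inV 0.
have p'E : p' = p + w0 *m M by rewrite -[RHS]e0 /aff mul0mx addr0.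
have [f fE] := choice inV.
pose A : 'M[Cplx R]_2 := \matrix_(i < 2) (f (delta_mx 0 i) - w0).
have M'E : M' = A *m M.
  apply/row_matrixP => i; rewrite row_mul rowK mulmxBl.
  have := fE (delta_mx 0 i); rewrite /aff p'E -rowE -addrA => /addrI <-.
  by rewrite addrAC subrr add0r.
exists w0, A; split=> //.
rewrite -row_full_unit /row_full eqn_leq rank_leq_col /=.
have rM' : \rank M' = 2 by apply/eqP.
by apply: (@leq_trans (\rank M')); [rewrite rM'|rewrite M'E mxrankM_maxl].
Qed.

(** The right-hand side is the image of the column under a fixed matrix of
C^3, which is why all minors are multiplied by one determinant. *)
Lemma coframe_change p M (w : 'rV[Cplx R]_2) (A : 'M[Cplx R]_2) k :
  coframe (p + w *m M) (A *m M) k =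
  let n := coframe p M k in
  Vec3 (v0 n + (w 0 0 : C) * v1 n + (w 0 1 : C) * v2 n)
       ((A 0 0 : C) * v1 n + (A 0 1 : C) * v2 n)
       ((A 1 0 : C) * v1 n + (A 1 1 : C) * v2 n).
Proof.
have E (n : nat) (B : 'M[Cplx R]_(n, 2)) i j :
    ((B *m M) i j : C) = (B i 0 : C) * (M 0 j : C) + (B i 1 : C) * (M 1 j : C).
  by rewrite mxE !big_ord_recl big_ord0 addr0 (_ : lift ord0 ord0 = 1)//; exact: val_inj.
rewrite /coframe; case: unliftP => [j _|_] /=.
  apply: vec3_eq; rewrite /= ?E //.
  by rewrite -addrA -E mxE.
by rewrite !mulr0 !addr0.
Qed.

Lemma det3_change (x y a b c d : C) (u v w : vec3 C) :
  let g n := Vec3 (v0 n + x * v1 n + y * v2 n) (a * v1 n + b * v2 n)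
                  (c * v1 n + d * v2 n) in
  det3 (g u) (g v) (g w) = (a * d - b * c) * det3 u v w.
Proof. by rewrite /det3 /pairing /cross /=; ring. Qed.

Lemma det2 (K : comRingType) (A : 'M[K]_2) :
  \det A = A 0 0 * A 1 1 - A 0 1 * A 1 0.
Proof.
rewrite (expand_det_row _ 0) !big_ord_recl big_ord0 addr0.
rewrite /cofactor !det_mx11 !mxE /= !expr0 expr1.
have l1 : lift ord0 ord0 = 1 :> 'I_2 by apply: val_inj.
have l0 : lift 1 0 = 0 :> 'I_2 by apply: val_inj.
by rewrite -[lift 0 0]/(lift ord0 ord0) !l1 l0 mul1r mulN1r mulrN.
Qed.

(** All minors get multiplied by the determinant of the change of frame, and the
cross-ratio numerator by the fourth power of its modulus. *)
Lemma generic_frame_change V p M p' M' :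
  affine_frame V p M -> affine_frame V p' M' ->
  generic_frame p M -> generic_frame p' M'.
Proof.
move=> fr fr' gen k; have [w [A [uA -> ->]]] := affine_frame_change fr fr'.
have := gen k; rewrite /frame_cross_ratio /cross_ratio_num !coframe_change.
rewrite !det3_change.
pose dl : C := (A 0 0 : C) * A 1 1 - (A 0 1 : C) * A 1 0.
have dl0 : dl != 0.
  have : \det A != 0 by rewrite -unitfE -unitmxE.
  by rewrite det2.
rewrite -/dl; set a := det3 _ _ _; set b := det3 _ _ _; set c := det3 _ _ _; set d := det3 _ _ _.
have cM (x y : C) : conjc (x * y) = conjc x * conjc y by rewrite rmorphM.
have nE (z : C) : z * conjc z = Complex (complex.Re z ^+ 2 + complex.Im z ^+ 2) 0.
  by case: z => x y; apply/eqP; rewrite eq_complex /=; apply/andP; split; apply/eqP; ring.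
have -> : dl * a * (dl * b) * conjc (dl * c * (dl * d)) =
    (dl * conjc dl) ^+ 2 * (a * b * conjc (c * d)).
  by rewrite !cM; ring.
have ImM (r : R) (z : C) : complex.Im (Complex r 0 * z) = r * complex.Im z.
  by case: z => x y /=; rewrite mul0r addr0.
have := sqr_norm_gt0 (complex_pair_neq0 dl0); rewrite nE => /lt0r_neq0 r0 q.
by rewrite expr2 -mulrA !ImM mulf_neq0// mulf_neq0.
Qed.

Definition frame_polynomial (g : 'rV[Cplx R]_4 -> 'M[Cplx R]_(2, 4) -> R) : Prop :=
  exists f : mpoly.mpoly ((1 + 2 + (1 + 2)) * 4) R,
    forall p M, mpoly.meval (frame_coords p M 0) f = g p M.

Definition frame_cpolynomial (g : 'rV[Cplx R]_4 -> 'M[Cplx R]_(2, 4) -> C) : Prop :=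
  frame_polynomial (fun p M => complex.Re (g p M)) /\
  frame_polynomial (fun p M => complex.Im (g p M)).

Lemma frame_polynomial_cst c : frame_polynomial (fun _ _ => c).
Proof. by exists (mpoly.mpolyC _ c) => p M; rewrite mpoly.mevalC. Qed.

Lemma frame_polynomialD f g : frame_polynomial f -> frame_polynomial g ->
  frame_polynomial (fun p M => f p M + g p M).
Proof.
move=> [P eP] [Q eQ].
have [S eS] : exists S, forall v,
    mpoly.meval v S = mpoly.meval v P + mpoly.meval v Q.
  by eexists => v; exact: mpoly.mevalD.
by exists S => p M; rewrite eS eP eQ.
Qed.

Lemma frame_polynomialB f g : frame_polynomial f -> frame_polynomial g ->
  frame_polynomial (fun p M => f p M - g p M).
Proof.
move=> [P eP] [Q eQ].
have [S eS] : exists S, forall v,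
    mpoly.meval v S = mpoly.meval v P - mpoly.meval v Q.
  by eexists => v; exact: mpoly.mevalB.
by exists S => p M; rewrite eS eP eQ.
Qed.

Lemma frame_polynomialM f g : frame_polynomial f -> frame_polynomial g ->
  frame_polynomial (fun p M => f p M * g p M).
Proof.
move=> [P eP] [Q eQ].
have [S eS] : exists S, forall v,
    mpoly.meval v S = mpoly.meval v P * mpoly.meval v Q.
  by eexists => v; exact: mpoly.mevalM.
by exists S => p M; rewrite eS eP eQ.
Qed.

Lemma frame_polynomial_coord i :
  frame_polynomial (fun p M => frame_coords p M 0 i).
Proof. by exists (mpoly.mpolyX R (mpoly.mnm1 i)) => p M; rewrite mpoly.mevalXU. Qed.

Lemma frame_polynomial_prod (I : Type) (r : seq I) (F : I -> _) :
  (forall i, frame_polynomial (F i)) ->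
  frame_polynomial (fun p M => \prod_(i <- r) F i p M).
Proof.
move=> pF; elim: r => [|i r [f fE]].
  have [f fE] := frame_polynomial_cst 1; exists f => p M.
  by rewrite fE big_nil.
have [g gE] := frame_polynomialM (pF i) (ex_intro _ f fE).
by exists g => p M; rewrite gE big_cons.
Qed.

Lemma frame_polynomial_eq f g : frame_polynomial f ->
  (forall p M, f p M = g p M) -> frame_polynomial g.
Proof. by move=> [P eP] fg; exists P => p M; rewrite eP fg. Qed.

Lemma frame_cpolynomial_cst c : frame_cpolynomial (fun _ _ => c).
Proof. by split; exact: frame_polynomial_cst. Qed.

Lemma frame_cpolynomialD f g : frame_cpolynomial f -> frame_cpolynomial g ->
  frame_cpolynomial (fun p M => f p M + g p M).
Proof.
move=> [rf cf] [rg cg]; split.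
  by apply: frame_polynomial_eq (frame_polynomialD rf rg) _ => p M; rewrite raddfD.
by apply: frame_polynomial_eq (frame_polynomialD cf cg) _ => p M; rewrite raddfD.
Qed.

Lemma frame_cpolynomialB f g : frame_cpolynomial f -> frame_cpolynomial g ->
  frame_cpolynomial (fun p M => f p M - g p M).
Proof.
move=> [rf cf] [rg cg]; split.
  by apply: frame_polynomial_eq (frame_polynomialB rf rg) _ => p M; rewrite raddfB.
by apply: frame_polynomial_eq (frame_polynomialB cf cg) _ => p M; rewrite raddfB.
Qed.

Lemma frame_cpolynomialM f g : frame_cpolynomial f -> frame_cpolynomial g ->
  frame_cpolynomial (fun p M => f p M * g p M).
Proof.
move=> [rf cf] [rg cg]; split.
  apply: frame_polynomial_eq (frame_polynomialB (frame_polynomialM rf rg)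
    (frame_polynomialM cf cg)) _ => p M.
  by case: (f p M) (g p M) => x y [x' y'].
apply: frame_polynomial_eq (frame_polynomialD (frame_polynomialM rf cg)
  (frame_polynomialM cf rg)) _ => p M.
by case: (f p M) (g p M) => x y [x' y'].
Qed.

Lemma frame_cpolynomial_conj f : frame_cpolynomial f ->
  frame_cpolynomial (fun p M => conjc (f p M)).
Proof.
move=> [rf cf]; split.
  by apply: frame_polynomial_eq rf _ => p M; case: (f p M).
apply: frame_polynomial_eq (frame_polynomialB (frame_polynomial_cst 0) cf) _ => p M.
by rewrite sub0r; case: (f p M).
Qed.

Lemma frame_cpolynomial_entry (i : 'I_(1 + 2)) j :
  frame_cpolynomial (fun p M => col_mx p M i j).
Proof.
split.
  apply: frame_polynomial_eq (frame_polynomial_coord (mxvec_index (lshift _ i) j)) _ => p M.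
  by rewrite /frame_coords mxvecE col_mxEu mxE.
apply: frame_polynomial_eq (frame_polynomial_coord (mxvec_index (rshift _ i) j)) _ => p M.
by rewrite /frame_coords mxvecE col_mxEd mxE.
Qed.

Lemma frame_cpolynomial_coframe k :
  [/\ frame_cpolynomial (fun p M => v0 (coframe p M k)),
      frame_cpolynomial (fun p M => v1 (coframe p M k)) &
      frame_cpolynomial (fun p M => v2 (coframe p M k))].
Proof.
rewrite /coframe; case: unliftP => [j _|_] /=; last by split; exact: frame_cpolynomial_cst.
have eM (i : 'I_2) : frame_cpolynomial (fun p M => M i j).
  have [[f fE] [g gE]] := frame_cpolynomial_entry (rshift 1 i) j.
  by split; [exists f|exists g] => p M; rewrite ?fE ?gE col_mxEd.
split; [|exact: eM|exact: eM].
have [[f fE] [g gE]] := frame_cpolynomial_entry (lshift 2 ord0) j.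
by split; [exists f|exists g] => p M; rewrite ?fE ?gE col_mxEu.
Qed.

Lemma frame_cpolynomial_det3 a b c : frame_cpolynomial (fun p M =>
  det3 (coframe p M a) (coframe p M b) (coframe p M c)).
Proof.
have [a0 a1 a2] := frame_cpolynomial_coframe a.
have [b0 b1 b2] := frame_cpolynomial_coframe b.
have [c0 c1 c2] := frame_cpolynomial_coframe c.
rewrite /det3 /pairing /cross /=.
by repeat first [assumption | apply: frame_cpolynomialB |
  apply: frame_cpolynomialD | apply: frame_cpolynomialM].
Qed.

Definition genericity_polynomial p M : R :=
  \prod_(k < 5) complex.Im (frame_cross_ratio p M k).

Lemma frame_polynomial_genericity : frame_polynomial genericity_polynomial.
Proof.
apply: frame_polynomial_prod => k.
suff : frame_cpolynomial (fun p M => frame_cross_ratio p M k) by case.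
rewrite /frame_cross_ratio /cross_ratio_num.
apply: frame_cpolynomialM; first by apply: frame_cpolynomialM; exact: frame_cpolynomial_det3.
by apply: frame_cpolynomial_conj; apply: frame_cpolynomialM; exact: frame_cpolynomial_det3.
Qed.

Lemma genericity_polynomialP p M :
  generic_frame p M <-> genericity_polynomial p M != 0.
Proof.
rewrite /genericity_polynomial; split=> [gen|/prodf_neq0 H k].
  by apply/prodf_neq0 => k _; exact: gen.
exact: H.
Qed.

Definition nongeneric_plane : set (set 'rV[Cplx R]_4) :=
  [set V | exists p M, affine_frame V p M /\ ~ generic_frame p M].

Lemma nongeneric_plane_algebraic : real_algebraic nongeneric_plane.
Proof.
split=> [V [p [M [fr _]]]|]; first by exists p, M.
have [f fE] := frame_polynomial_genericity.
exists [set f] => V p M fr; split.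
  move=> [p' [M' [fr' ngen]]] _ ->; rewrite fE; apply/eqP; apply: contrapT.
  move/negP/genericity_polynomialP => gen; apply: ngen.
  exact: generic_frame_change fr fr' gen.
move=> H; exists p, M; split=> // /genericity_polynomialP.
by rewrite -fE H ?eqxx.
Qed.

Definition example_point : 'rV[Cplx R]_4 := \row_j nth 0 [:: 0; 0; 1; 1] j.
Definition example_matrix : 'M[Cplx R]_(2, 4) := \matrix_(i, j)
  nth 0 (nth [::] [:: [:: 1; 0; 1; Complex 0 1 : C];
                      [:: 0; 1; 1; Complex 1 2 : C]] i) j.

Definition example_coframe (k : nat) : vec3 C := nth (zero3 C)
 [:: Vec3 1 0 0; Vec3 0 1 0; Vec3 0 0 1; Vec3 1 1 1; Vec3 1 (Complex 0 1) (Complex 1 2)] k.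

Lemma example_coframeE k : coframe example_point example_matrix k = example_coframe k.
Proof.
rewrite /coframe; case: unliftP => [j ->|->] //.
by case: j => [[|[|[|[|//]]]] jP]; rewrite !mxE.
Qed.

Lemma generic_frame_example : generic_frame example_point example_matrix.
Proof.
move=> k; rewrite /frame_cross_ratio !example_coframeE /cross_ratio_num.
(* Once the indices are computed, each value is an explicit numeral expression,
   and [done] separates it from 0 by interval arithmetic. *)
case: k => [[|[|[|[|[|//]]]]] kP] /=; rewrite /bump !inordK //=.
Qed.

End Genericity.

(** The plane spanned by [example_point] and [example_matrix] is generic. *)
Lemma nongeneric_plane_proper (R : realType) :
  @nongeneric_plane R <> @affine_plane R.
Proof.
move=> e; have fM : row_free (example_matrix R).
  apply/row_freeP; exists (\matrix_(i < 4, j < 2) ((i : nat) == j)%:R).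
  apply/matrixP => i j; rewrite !mxE !big_ord_recl big_ord0 !mxE /=.
  case: i j => [[|[|//]] ?] [[|[|//]] ?] /=; by rewrite !(mulr0, mulr1, mul0r, addr0, add0r).
have fr : affine_frame (range (aff (example_point R) (example_matrix R))) (example_point R) (example_matrix R) by split.
have : affine_plane (range (aff (example_point R) (example_matrix R))).
  by exists (example_point R), (example_matrix R).
rewrite -e => -[p [M [fr' ng]]]; apply: ng.
exact: generic_frame_change fr fr' (@generic_frame_example R).
Qed.

(** * The differential of the rolled coamoeba map *)

Section Differentials.
Variable R : realType.

(** The expression of f at first order only involves the germ of f. *)
Lemma near_differentiable (V W : normedModType R) (f g : V -> W) x :
  (\forall y \near x, f y = g y) -> differentiable g x -> differentiable f x.
Proof.
move=> fg dg; have [cg eg] := (diff_locallyP x g).1 dg.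
have fgx : f x = g x by exact: (nbhs_singleton fg).
have ef : f \o shift x = cst (f x) + 'd g x +o_ 0 id.
  apply/eqaddoP => e e0; have /eqaddoP/(_ e e0) := eg.
  have fg0 : \forall h \near (0 : V), f (h + x) = g (h + x).
    by move: fg; rewrite (near_shift 0) subr0.
  apply: filterS2 fg0 => h e1.
  by rewrite /= !fctE /= e1 fgx.
apply/diff_locallyP; rewrite (diff_unique cg ef).
by split.
Qed.

Lemma differentiable_row m n (g : 'I_n -> 'rV[R]_m -> R) x :
  (forall j, differentiable (g j) x) ->
  differentiable (fun y => \row_j g j y : 'rV[R]_n) x.
Proof.
move=> dg.
have -> : (fun y => \row_j g j y : 'rV[R]_n) =
    \sum_(j < n) (fun y => g j y *: (delta_mx 0 j : 'rV[R]_n)).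
  apply/funext => y; rewrite fct_sumE [LHS]row_sum_delta.
  by apply: eq_bigr => j _; rewrite mxE.
by apply: differentiable_sum => j; exact: differentiableZl.
Qed.

Lemma differentiable_affine m (c : R) (N : 'cV[R]_m) (x : 'rV[R]_m) :
  differentiable (fun y : 'rV[R]_m => c + (y *m N) 0 0) x.
Proof.
have -> : (fun y : 'rV[R]_m => c + (y *m N) 0 0) =
    cst c + \sum_(i < m) (N i 0 *: (fun y : 'rV[R]_m => y 0 i : R)).
  apply/funext => y; rewrite fctE fct_sumE /= mxE; congr (_ + _).
  by apply: eq_bigr => i _; rewrite mulrC.
apply: differentiableD; first exact: differentiable_cst.
apply: differentiable_sum => i; apply: differentiableZ.
exact: differentiable_coord.
Qed.

Lemma derive_affine m (c : R) (N : 'cV[R]_m) (x v : 'rV[R]_m) :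
  'D_v (fun y : 'rV[R]_m => c + (y *m N) 0 0) x = (v *m N) 0 0.
Proof.
rewrite /derive; apply: cvg_lim => //.
apply: (@cvg_trans _ ((fun _ : R => (v *m N) 0 0) @ 0^')); last exact: cvg_cst.
apply: near_eq_cvg; near=> h.
rewrite /= mulmxDl -scalemxAl !mxE opprD addrACA subrr add0r addrK.
rewrite /GRing.scale /= mulrA mulVf ?mul1r//.
by near: h; exact: nbhs_dnbhs_neq.
Unshelve. all: by end_near. Qed.

Lemma differentiable_quotient m (f g : 'rV[R]_m -> R) x :
  differentiable f x -> differentiable g x -> g x != 0 ->
  differentiable (fun y => f y / g y) x.
Proof.
move=> df dg g0.
have := differentiableM df (differentiableV dg g0).
by [].
Qed.

Lemma derive_quotient m (f g : 'rV[R]_m -> R) x v :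
  differentiable f x -> differentiable g x -> g x != 0 ->
  'D_v (fun y => f y / g y) x =
  ('D_v f x * g x - f x * 'D_v g x) / g x ^+ 2.
Proof.
move=> df dg g0.
have df' := diff_derivable (v := v) df; have dg' := diff_derivable (v := v) dg.
have := deriveM df' (derivableV g0 dg').
rewrite deriveV// /GRing.scale /= => e; rewrite [LHS]e.
by field.
Qed.

End Differentials.

Lemma linear_not_surjective (R : realType) n (f : {linear 'rV[R]_n -> 'rV[R]_n}) :
  range f <> setT <-> exists2 v, v != 0 & f v = 0.
Proof.
pose A := lin1_mx f.
have fA v : f v = v *m A by rewrite mul_rV_lin1.
split=> [nsurj|[v v0 fv0] surj].
  have nA : ~~ row_free A.
    apply/negP; rewrite row_free_unit => uA; apply: nsurj; apply/seteqP; split=> // w _.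
    by exists (w *m invmx A) => //; rewrite fA mulmxKV.
  move: nA; rewrite -kermx_eq0 => /rowV0Pn [v /sub_kermxP vA v0].
  by exists v; rewrite // fA.
have : row_free A.
  rewrite row_free_unit -row_full_unit; apply/row_fullP.
  have /choice [g gE] : forall i : 'I_n, exists w, f w = delta_mx 0 i.
    move=> i; have : [set: 'rV[R]_n] (delta_mx 0 i) by [].
    by rewrite -surj => -[w _ fw]; exists w.
  exists (\matrix_i g i); apply/row_matrixP => i.
  by rewrite row_mul rowK -fA gE row1.
move=> /row_free_inj inj; move/eqP : v0; apply; apply: (inj _ v 0).
by rewrite -fA fv0 mul0mx.
Qed.

Section CriticalPoints.
Variable R : realType.
Local Notation C := R[i].
Implicit Types (p : 'rV[Cplx R]_4) (M : 'M[Cplx R]_(2, 4)) (u v : 'rV[R]_(2 + 2)).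

Lemma chart_dom_hcoord c (x y : R) : (x, y) != 0 :> R * R ->
  chart_dom c (hcoord x y) <-> (if c then y else x) != 0.
Proof.
move=> h; have := hrepr_neq0 (hcoord x y); have := hrepr_hcoord h.
rewrite /chart_dom /=; case: (hrepr _) => a b /= e; rewrite pair_neq0 => ab.
rewrite pair_neq0 in h.
case: c; split=> n0.
- apply: contraTneq n0 => y0; move: e h; rewrite y0 mulr0 eqxx orbF => /esym/eqP.
  by rewrite mulf_eq0 negbK => /orP[->|->].
- apply: contraTneq n0 => b0; move: e ab; rewrite b0 mulr0 eqxx orbF => /eqP.
  by rewrite mulf_eq0 negbK => /orP[->|->].
- apply: contraTneq n0 => x0; move: e h; rewrite x0 mul0r eqxx /= => /eqP.
  by rewrite mulf_eq0 negbK => /orP[->|->].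
- apply: contraTneq n0 => a0; move: e ab; rewrite a0 mul0r eqxx /= => /esym/eqP.
  by rewrite mulf_eq0 negbK => /orP[->|->].
Qed.

Lemma chart_hcoord c (x y : R) : (if c then y else x) != 0 ->
  chart c (hcoord x y) = if c then x / y else y / x.
Proof.
move=> n0; have h : (x, y) != 0 :> R * R.
  by rewrite pair_neq0; case: c n0 => ->; rewrite ?orbT.
have := (chart_dom_hcoord c h).2 n0; have := hrepr_hcoord h.
rewrite /chart_dom /chart /=; case: (hrepr _) => a b /= e.
case: c n0 => n0 m0.
  by apply: (mulIf m0); apply: (mulIf n0); rewrite divfK// e mulrAC divfK.
by apply: (mulIf m0); apply: (mulIf n0); rewrite divfK// mulrAC divfK// mulrC -e mulrC.
Qed.

Lemma complexify0 : complexify 0 = 0 :> 'rV[Cplx R]_2.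
Proof.
by apply/rowP => k; apply/eqP; rewrite eq_complex !mxE /= ?mxE eqxx.
Qed.

Lemma aff_Re p M u j : complex.Re (aff p M (complexify u) 0 j) =
  complex.Re (p 0 j) + (u *m (\col_l re_forms p M (lift ord0 (l : 'I_4)) (lift ord0 j))) 0 0.
Proof.
rewrite -hform_aff -re_formsE mxE big_ord_recl; congr (_ + _).
  rewrite mxE unlift_none mul1r mxE.
  have -> : delta_mx 0 ord0 = homog 1 0 :> 'rV[R]_5.
    by apply/rowP => i; rewrite !mxE; case: unliftP => [l ->|->]; rewrite ?mxE.
  rewrite hform_lift mul1r.
  by rewrite complexify0 mul0mx mxE addr0.
by rewrite mxE; apply: eq_bigr => l _; rewrite !mxE liftK.
Qed.

Lemma aff_Im p M u j : complex.Im (aff p M (complexify u) 0 j) =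
  complex.Im (p 0 j) + (u *m (\col_l im_forms p M (lift ord0 (l : 'I_4)) (lift ord0 j))) 0 0.
Proof.
rewrite -hform_aff -im_formsE mxE big_ord_recl; congr (_ + _).
  rewrite mxE unlift_none mul1r mxE.
  have -> : delta_mx 0 ord0 = homog 1 0 :> 'rV[R]_5.
    by apply/rowP => i; rewrite !mxE; case: unliftP => [l ->|->]; rewrite ?mxE.
  rewrite hform_lift mul1r.
  by rewrite complexify0 mul0mx mxE addr0.
by rewrite mxE; apply: eq_bigr => l _; rewrite !mxE liftK.
Qed.

Lemma direction_Re p M v j : complex.Re ((complexify v *m M) 0 j) =
  (v *m (\col_l re_forms p M (lift ord0 (l : 'I_4)) (lift ord0 j))) 0 0.
Proof.
have := aff_Re p M v j; rewrite /aff mxE raddfD => /addrI; exact.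
Qed.

Lemma direction_Im p M v j : complex.Im ((complexify v *m M) 0 j) =
  (v *m (\col_l im_forms p M (lift ord0 (l : 'I_4)) (lift ord0 j))) 0 0.
Proof.
have := aff_Im p M v j; rewrite /aff mxE raddfD => /addrI; exact.
Qed.

(** The derivative of x / y along v vanishes iff x' y = x y': the j-th component
of the differential kills v iff the variation of z_j along v is a real multiple
of z_j, whichever of the two charts is used. *)
Lemma coord_expr_critical p M c u :
  (forall j, aff p M (complexify u) 0 j != 0) ->
  (forall j, chart_dom (c j) (TwoArg (aff p M (complexify u)) j)) ->
  range ('d (coord_expr p M c) u) <> setT <->
  exists2 v, v != 0 & forall j,
    complex.Re (aff p M (complexify u) 0 j) * complex.Im ((complexify v *m M) 0 j) =
    complex.Im (aff p M (complexify u) 0 j) * complex.Re ((complexify v *m M) 0 j).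
Proof.
move=> z0 cd; rewrite linear_not_surjective.
pose x j (y : 'rV[R]_(2 + 2)) := complex.Re (aff p M (complexify y) 0 j).
pose y j (w : 'rV[R]_(2 + 2)) := complex.Im (aff p M (complexify w) 0 j).
have dx j w : differentiable (x j) w.
  rewrite /x (_ : (fun _ => _) = (fun w => complex.Re (p 0 j) + (w *m (\col_l re_forms p M (lift ord0 (l : 'I_4)) (lift ord0 j))) 0 0)).
    exact: differentiable_affine.
  by apply/funext => w'; exact: aff_Re.
have dy j w : differentiable (y j) w.
  rewrite /y (_ : (fun _ => _) = (fun w => complex.Im (p 0 j) + (w *m (\col_l im_forms p M (lift ord0 (l : 'I_4)) (lift ord0 j))) 0 0)).
    exact: differentiable_affine.
  by apply/funext => w'; exact: aff_Im.
have Dx j w v : 'D_v (x j) w = complex.Re ((complexify v *m M) 0 j).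
  rewrite (direction_Re p) -(@derive_affine R _ (complex.Re (p 0 j)) _ w); congr ('D_v _ w).
  by apply/funext => w'; exact: aff_Re.
have Dy j w v : 'D_v (y j) w = complex.Im ((complexify v *m M) 0 j).
  rewrite (direction_Im p) -(@derive_affine R _ (complex.Im (p 0 j)) _ w); congr ('D_v _ w).
  by apply/funext => w'; exact: aff_Im.
pose g j w := if c j then x j w / y j w else y j w / x j w.
have n0 j : (if c j then y j u else x j u) != 0.
  exact: ((chart_dom_hcoord (c j) (complex_pair_neq0 (z0 j))).1 (cd j)).
have dg j : differentiable (g j) u.
  have := n0 j; rewrite /g; case: (c j) => m0; exact: differentiable_quotient.
have near_g : \forall w \near u, coord_expr p M c w = \row_j g j w.
  have : \forall w \near u, forall j, (if c j then y j w else x j w) != 0.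
    apply: (@filter_forall _ _ _ (nbhs u)) => j.
    have cj : continuous_at u (fun w => if c j then y j w else x j w).
      by case: (c j); apply: differentiable_continuous.
    have oN : open [set t : R | t != 0].
      rewrite (_ : [set t | _] = ~` [set 0]); last by apply/seteqP; split=> t /= /eqP.
      apply: closed_openC; apply: accessible_closed_set1.
      exact: hausdorff_accessible (@Rhausdorff R).
    exact: (cj _ (open_nbhs_nbhs (conj oN (n0 j)))).
  apply: filterS => w nw; apply/rowP => j; rewrite !mxE /TwoArg /two_arg.
  by rewrite chart_hcoord//; exact: nw.
have df : differentiable (coord_expr p M c) u.
  by apply: near_differentiable near_g _; exact: differentiable_row.
have D v : 'd (coord_expr p M c) u v = \row_j 'D_v (g j) u.
  rewrite -deriveE// (near_eq_derive v near_g) derive_mx.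
    apply/rowP => j; rewrite !mxE; congr ('D_v _ u).
    by apply/funext => w; rewrite mxE.
  by apply/diff_derivable; exact: differentiable_row.
have Dg j v : 'D_v (g j) u = 0 <-> x j u * complex.Im ((complexify v *m M) 0 j) =
    y j u * complex.Re ((complexify v *m M) 0 j).
  have := n0 j; rewrite /g; case: (c j) => m0.
    rewrite derive_quotient// Dx Dy; split=> [/eqP|e].
      rewrite mulf_eq0 invr_eq0 expf_eq0 (negbTE m0) andbF orbF subr_eq0 => /eqP <-.
      by rewrite mulrC.
    by rewrite e [_ * y j u]mulrC subrr mul0r.
  rewrite derive_quotient// Dx Dy; split=> [/eqP|e].
    rewrite mulf_eq0 invr_eq0 expf_eq0 (negbTE m0) andbF orbF subr_eq0 => /eqP <-.
    by rewrite mulrC.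
  by rewrite -e [_ * x j u]mulrC subrr mul0r.
split=> -[v v0 H]; exists v => //.
  by move=> j; apply/Dg; have /rowP/(_ j) := H; rewrite D !mxE.
by rewrite D; apply/rowP => j; rewrite !mxE; apply/Dg; exact: H.
Qed.

End CriticalPoints.

(** * The topology of the complex numbers *)

Section ComplexTopology.
Variable R : realType.
Local Notation C := R[i].

Lemma cplx_gt0 (e : Cplx R) : 0 < e -> exists2 r : R, 0 < r & e = (Complex r 0 : C).
Proof.
case: e => r s; rewrite (ltcE (0 : C)) /= => /andP[/eqP s0 r0].
by exists r => //; rewrite s0.
Qed.

Lemma cplx_norm_lt (z : Cplx R) (e : R) : `|z| < (Complex e 0 : Cplx R) ->
  `|complex.Re z| < e /\ `|complex.Im z| < e.
Proof.
rewrite [`|z|](normc_def (z : C)) (ltcE (_ : C)) /= => /andP[_ h].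
split; apply: le_lt_trans h; rewrite -sqrtr_sqr ler_sqrt ?addr_ge0 ?sqr_ge0//.
  by rewrite lerDl sqr_ge0.
by rewrite lerDr sqr_ge0.
Qed.

Lemma cplx_norm_ltD (x y : R) (e : R) : `|x| < e / 2 -> `|y| < e / 2 ->
  `|Complex x y : Cplx R| < (Complex e 0 : Cplx R).
Proof.
move=> hx hy; rewrite [`|_|](normc_def (Complex x y : C)) (ltcE (_ : C)) /= eqxx /=.
have e0 : 0 < e / 2 by apply: le_lt_trans hx.
have -> : e = Num.sqrt (e ^+ 2) by rewrite sqrtr_sqr gtr0_norm//; lra.
rewrite ltr_sqrt; last by rewrite exprn_gt0//; lra.
rewrite -(real_normK (num_real x)) -(real_normK (num_real y)).
have h1 : `|x| ^+ 2 < (e / 2) ^+ 2 by rewrite ltr_pXn2r ?nnegrE// ltW.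
have h2 : `|y| ^+ 2 < (e / 2) ^+ 2 by rewrite ltr_pXn2r ?nnegrE// ltW.
by have : 0 < e ^+ 2; [rewrite exprn_gt0//; lra|]; rewrite expr_div_n in h1 h2; lra.
Qed.

Lemma Re_Im_continuous (z : Cplx R) :
  continuous_at z (fun z : Cplx R => complex.Re z) /\
  continuous_at z (fun z : Cplx R => complex.Im z).
Proof.
have H (e : R) : 0 < e -> \forall w \near z, `|z - w| < (Complex e 0 : Cplx R).
  move=> e0; have eC : 0 < (Complex e 0 : Cplx R) by rewrite (ltcE (0 : C)) /= eqxx.
  exact: ((@cvgrPdist_lt _ (Cplx R) _ (nbhs z) _ id z).1 (@cvg_id _ _) _ eC).
have ReB (w : Cplx R) : complex.Re (z - w) = complex.Re z - complex.Re w.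
  by case: (z) w => x y [].
have ImB (w : Cplx R) : complex.Im (z - w) = complex.Im z - complex.Im w.
  by case: (z) w => x y [].
split; apply: (iffRL (@cvgrPdist_lt _ R _ (nbhs z) _ _ _)) => e e0.
  by apply: (@filterS _ (nbhs z) _ _ _ _ (H e e0)) => w /cplx_norm_lt []; rewrite ReB.
by apply: (@filterS _ (nbhs z) _ _ _ _ (H e e0)) => w /cplx_norm_lt []; rewrite ImB.
Qed.

Lemma continuous_at_Complex (T : topologicalType) (f g : T -> R) t :
  continuous_at t f -> continuous_at t g ->
  continuous_at t (fun s => Complex (f s) (g s) : Cplx R).
Proof.
move=> cf cg; apply: (iffRL (@cvgrPdist_lt _ (Cplx R) _ (nbhs t) _ _ _)) => _ /cplx_gt0 [r r0 ->].
have r2 : 0 < r / 2 by rewrite divr_gt0.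
have hf := (@cvgrPdist_lt _ R _ (nbhs t) _ f (f t)).1 cf (r / 2) r2.
have hg := (@cvgrPdist_lt _ R _ (nbhs t) _ g (g t)).1 cg (r / 2) r2.
near=> s; apply: (@cplx_norm_ltD (f t - f s) (g t - g s)); near: s.
  exact: hf.
exact: hg.
Unshelve. all: by end_near.
Qed.

End ComplexTopology.

(** * The critical locus of a generic plane *)

Section Plane.
Variable R : realType.
Local Notation C := R[i].
Variables (V : set 'rV[Cplx R]_4) (p : 'rV[Cplx R]_4) (M : 'M[Cplx R]_(2, 4)).
Hypothesis frV : affine_frame V p M.
Hypothesis gen : generic_frame p M.
Local Notation X := (re_forms p M).
Local Notation Y := (im_forms p M).
Local Notation Z := (set_type (@critical_points R V)).
Local Notation E := (set_type (bundle_space X Y)).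

Definition realify (w : 'rV[Cplx R]_2) : 'rV[R]_(2 + 2) :=
  row_mx (\row_k complex.Re (w 0 k)) (\row_k complex.Im (w 0 k)).

Lemma realifyK w : complexify (realify w) = w.
Proof.
apply/rowP => k; rewrite /complexify row_mxKl row_mxKr !mxE.
by case: (w 0 k).
Qed.

Definition coords (z : 'rV[Cplx R]_4) : 'rV[R]_(2 + 2) :=
  realify ((z - p) *m pinvmx M).

Lemma coordsK z : V z -> aff p M (complexify (coords z)) = z.
Proof.
case: frV => fM -> [w _ <-]; rewrite /coords realifyK /aff addrAC subrr add0r.
by rewrite -[w *m M *m _]mulmxA mulmxVp// mulmx1.
Qed.

Lemma aff_coords u : coords (aff p M (complexify u)) = u.
Proof.
case: frV => fM _; apply: complexify_inj.
by rewrite /coords realifyK /aff addrAC subrr add0r -mulmxA mulmxVp// mulmx1.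
Qed.

Lemma coords_continuous : continuous coords.
Proof.
move=> z.
have c k : continuous_at z (fun z : 'rV[Cplx R]_4 => ((z - p) *m pinvmx M) 0 k).
  apply: (@continuous_at_ext _ _ (fun z : 'rV[Cplx R]_4 => \sum_j (z 0 j - p 0 j) * pinvmx M j k)).
    apply: continuous_at_sum => j _; apply: continuous_atM; last exact: continuous_at_cst.
    by apply: continuous_atB; [exact: continuous_entry|exact: continuous_at_cst].
  by move=> w; rewrite mxE; apply: eq_bigr => j _; rewrite !mxE.
apply: continuous_at_mx => i l; rewrite ord1.
have [k ->|k ->] := split_ordP l.
  apply: (@continuous_at_ext R _ (fun z : 'rV[Cplx R]_4 => complex.Re (((z - p) *m pinvmx M) 0 k))); last first.
    by move=> w; rewrite /coords /realify row_mxEl [RHS]mxE.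
  by apply: (@continuous_at_comp _ _ _ _ (fun z : Cplx R => complex.Re z)); [exact: c|have [] := Re_Im_continuous (((z - p) *m pinvmx M) 0 k)].
apply: (@continuous_at_ext R _ (fun z : 'rV[Cplx R]_4 => complex.Im (((z - p) *m pinvmx M) 0 k))); last first.
  by move=> w; rewrite /coords /realify row_mxEr [RHS]mxE.
by apply: (@continuous_at_comp _ _ _ _ (fun z : Cplx R => complex.Im z)); [exact: c|have [] := Re_Im_continuous (((z - p) *m pinvmx M) 0 k)].
Qed.

Lemma aff_continuous (T : topologicalType) (f : T -> 'rV[R]_(2 + 2)) t :
  continuous_at t f -> continuous_at t (fun s => aff p M (complexify (f s))).
Proof.
move=> cf; have ce l : continuous_at t (fun s => f s 0 l).
  by apply: (@continuous_at_comp _ _ _ f (fun M => M 0 l)) => //; exact: continuous_entry.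
apply: continuous_at_mx => i j; rewrite ord1.
apply: (@continuous_at_ext (Cplx R) _ (fun s => p 0 j + \sum_k
   (Complex (f s 0 (lshift 2 k)) (f s 0 (rshift 2 k)) : Cplx R) * M k j)).
  apply: continuous_atD; first exact: continuous_at_cst.
  apply: continuous_at_sum => k _; apply: continuous_atM; last exact: continuous_at_cst.
  exact: continuous_at_Complex.
move=> s; rewrite /aff [RHS]mxE [X in _ = _ + X]mxE; congr (_ + _).
by apply: eq_bigr => k _; rewrite !mxE.
Qed.

Lemma hform_coords z j : V z ->
  hform p M (homog 1 (coords z)) (lift ord0 j) = z 0 j.
Proof. by move=> Vz; rewrite hform_aff coordsK. Qed.

Lemma fiber_coords (z : set_type (torus_part V)) :
  fiber X Y (rolled_coamoeba z) (homog 1 (coords (set_val z))).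
Proof.
have [Vz z0] := set_valP z.
apply/fiber_hform => j; rewrite hform_coords//.
exact: (on_line_hcoord_self (complex_pair_neq0 (z0 j))).
Qed.

(** A direction d of V killed by the differential is the same as a vector
of W_b with h_0 = 0. The condition on d does not involve the frame or the
charts used to express the differential. *)
Lemma critical_pointsP (z : set_type (torus_part V)) :
  critical_points z <->
  exists h : 'rV[R]_5, [/\ h != 0, h 0 ord0 = 0 & fiber X Y (rolled_coamoeba z) h].
Proof.
have [Vz z0] := set_valP z; have [fM VE] := frV.
have inV y : V y -> exists w, aff p M w = y.
  by rewrite VE => -[w _ <-]; exists w.
split.
  case=> p' [M' [u [c [[fM' VE'] zE cd]]]].
  have zj j : aff p' M' (complexify u) 0 j != 0 by rewrite -zE.
  have cd' j : chart_dom (c j) (TwoArg (aff p' M' (complexify u)) j).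
    by rewrite -zE; exact: cd.
  move/(coord_expr_critical zj cd') => [v v0 H].
  have V'in w : V (aff p' M' w) by rewrite VE'; exists w.
  have := V'in (complexify u + complexify v).
  rewrite /aff mulmxDl addrA -/(aff p' M' _) -zE => /inV [w2 e2].
  have [w1 e1] : exists w, aff p M w = set_val z by exact: inV.
  have dE : complexify v *m M' = (w2 - w1) *m M.
    apply: (addrI (set_val z)); rewrite -e2 -e1 /aff mulmxBl.
    by rewrite -addrA [w1 *m M + _]addrC subrK.
  exists (homog 0 (realify (w2 - w1))); split.
  - apply: contra_neq v0 => h0; apply: complexify_inj; rewrite complexify0.
    apply: (row_free_inj fM'); rewrite mul0mx dE.
    rewrite -(realifyK (w2 - w1)) -(affine_part_homog 0 (realify _)) h0.
    by rewrite (_ : affine_part 0 = 0) ?complexify0 ?mul0mx//; apply/rowP => l; rewrite !mxE.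
  - exact: homog0.
  - apply/fiber_hform => j; rewrite hform_lift mul0r add0r realifyK -dE.
    apply/on_line_hcoord; first exact: complex_pair_neq0.
    by have := H j; rewrite -zE mulrC => ->; rewrite mulrC.
case=> h [h0 hz fh].
pose u := coords (set_val z).
(* a chart of each projective line around the argument of z_j *)
pose c (j : 'I_4) : bool := complex.Im (set_val z 0 j) != 0.
have zE : set_val z = aff p M (complexify u) by rewrite coordsK.
have cd j : chart_dom (c j) (rolled_coamoeba z j).
  apply/chart_dom_hcoord; first exact: complex_pair_neq0.
  rewrite /c; case: ifPn => // /negPn/eqP i0.
  by have := complex_pair_neq0 (z0 j); rewrite pair_neq0 i0 eqxx orbF.
exists p, M, u, c; split=> //.
apply/coord_expr_critical.
- by move=> j; rewrite -zE.
- by move=> j; rewrite -zE; exact: cd.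
exists (affine_part h).
  apply: contraNneq h0 => a0; rewrite -(homogK h) hz a0.
  by apply/eqP/rowP => i; rewrite !mxE; case: unliftP => // l _; rewrite mxE.
move=> j; rewrite -zE.
have := (fiber_hform p M _ h).2 fh j.
rewrite -{1 2}(homogK h) hz hform_lift mul0r add0r.
move/(on_line_hcoord _ _ (complex_pair_neq0 (z0 j))) => e.
by rewrite mulrC -e mulrC.
Qed.

Lemma critical_direction_of_point (z : Z) : critical_direction X Y (rolled_coamoeba (set_val z)).
Proof.
have [h [h0 hz fh]] := (critical_pointsP _).1 (set_valP z).
exists h, (homog 1 (coords (set_val (set_val z)))); split=> //.
  exact: fiber_coords.
move=> c /rowP/(_ ord0); rewrite homog0 mxE hz mulr0 => /eqP.
by rewrite oner_eq0.
Qed.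

Lemma homog1_neq0 u : homog 1 u != 0 :> 'rV[R]_5.
Proof.
apply/eqP => /rowP/(_ ord0); rewrite homog0 mxE => /eqP.
by rewrite oner_eq0.
Qed.

Lemma critical_embedding_bundle_space (z : Z) : bundle_space X Y
  (rolled_coamoeba (set_val z), projector (homog 1 (coords (set_val (set_val z))))).
Proof.
split=> /=; first exact: critical_direction_of_point.
by exists (homog 1 (coords (set_val (set_val z)))); split; [exact: homog1_neq0|exact: fiber_coords|].
Qed.

(** The critical point z with parameter u goes to the real line of (1, u). *)
Definition critical_embedding (z : Z) : E := sub_elt (critical_embedding_bundle_space z).

(** Since F_0 does not vanish at h, one may rescale to h_0 = 1; since the other
forms do not vanish, the resulting point of V lies in the torus. *)
Lemma vector_of_point b h : critical_direction X Y b -> fiber X Y b h ->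
  (forall k, ~ vanishing X Y k h) -> exists z : Z,
  rolled_coamoeba (set_val z) = b /\
  projector (homog 1 (coords (set_val (set_val z)))) = projector h.
Proof.
move=> cb fh nh.
have hz : h 0 ord0 != 0.
  by apply/eqP => h0; apply: (nh ord0); apply/vanishing_hform; rewrite hform_ord0 h0.
pose g := (h 0 ord0)^-1 *: h.
have gE : g = homog 1 (affine_part g) by rewrite -[LHS]homogK /g mxE mulVf.
have fg : fiber X Y b g by exact: fiberZ.
have ng j : hform p M g (lift ord0 j) != 0.
  apply/eqP => /vanishing_hform vg; apply: (nh (lift ord0 j)).
  by have := vanishingZ (h 0 ord0) vg; rewrite /g scalerA divff// scale1r.
pose z := aff p M (complexify (affine_part g)).
have zE j : z 0 j = hform p M g (lift ord0 j) by rewrite gE hform_aff.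
have Vz : V z by case: frV => _ ->; exists (complexify (affine_part g)).
have tz : torus_part V z by split=> // j; rewrite zE.
pose z1 : set_type (torus_part V) := sub_elt tz.
have zb : rolled_coamoeba z1 = b.
  apply/funext => j; apply: hcoord_on_line.
    by rewrite set_valE; apply: complex_pair_neq0; rewrite zE.
  rewrite set_valE [_ z1]/= zE; exact: ((fiber_hform p M b g).2 fg j).
have cz : critical_points z1.
  apply/critical_pointsP; have [h' [h'0 fh' vh']] := critical_vanishing ord0 cb.
  exists h'; split=> //; last by rewrite zb.
  by move/vanishing_hform : vh'; rewrite hform_ord0 => -[].
exists (sub_elt cz); split; first by rewrite set_valE.
rewrite !set_valE /= /z aff_coords -gE projectorZ// invr_eq0//.
Qed.

Lemma critical_valuesE : critical_values V = [set b | critical_direction X Y b].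
Proof.
apply/seteqP; split=> b.
  move=> [z cz <-]; exact: (critical_direction_of_point (sub_elt cz)).
move=> /= cb; have [h [fh nh]] := fiber_nonvanishing (generic_frame_fiber gen) cb.
have [z [zb _]] := vector_of_point cb fh nh.
by exists (set_val z) => //; exact: set_valP.
Qed.

Lemma critical_embedding_range : range critical_embedding = [set x | forall k, ~ on_divisor k x].
Proof.
apply/seteqP; split=> [_ [z _ <-] k|x nx].
  rewrite /on_divisor /critical_embedding set_valE /= => /(projector_vanishing X Y k (homog1_neq0 _)).
  move/vanishing_hform.
  have [Vz z0] := set_valP (set_val z).
  have [j ->|->] := unliftP ord0 k.
    by rewrite hform_coords// => /eqP; rewrite (negbTE (z0 j)).
  by rewrite hform_ord0 homog0 => -[/eqP]; rewrite oner_eq0.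
have [cb [h [h0 fh eh]]] := set_valP x.
have nh k : ~ vanishing X Y k h.
  by move=> /(projector_vanishing X Y k h0); rewrite -eh; exact: nx.
have [z [zb zh]] := vector_of_point cb fh nh.
exists z => //; apply: val_inj; by rewrite /= zb zh -eh -surjective_pairing.
Qed.

(** A continuous inverse of [critical_embedding], defined wherever the projector
has a nonzero corner entry, that is, away from infinity. *)
Definition point_of (x : E) : 'rV[Cplx R]_4 :=
  aff p M (complexify (\row_l ((set_val x).2 ord0 (lift ord0 (l : 'I_4)) /
                                (set_val x).2 ord0 ord0))).

Lemma point_ofK z : point_of (critical_embedding z) = set_val (set_val z).
Proof.
have [Vz _] := set_valP (set_val z).
rewrite -[RHS]coordsK//; congr (aff p M (complexify _)).
rewrite /critical_embedding set_valE /=; move: (coords _) => u.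
apply/rowP => l; rewrite !mxE unlift_none liftK !mul1r.
by rewrite invrK divfK// gt_eqF// dot_gt0// homog1_neq0.
Qed.

Lemma point_of_continuous (x : E) : (set_val x).2 ord0 ord0 != 0 ->
  continuous_at x point_of.
Proof.
move=> x0; apply: aff_continuous; apply: continuous_at_mx => i l.
have cE k m : continuous (fun x : E => (set_val x).2 k m).
  by apply: projection_entry_continuous => y; exact: cvg_id.
apply: (@continuous_at_ext R _ (fun x : E => (set_val x).2 ord0 (lift ord0 (l : 'I_4)) /
                                (set_val x).2 ord0 ord0)); last first.
  by move=> y; rewrite mxE.
apply: continuous_atM; first exact: cE.
by apply: continuous_atV => //; exact: cE.
Qed.

Lemma critical_embedding_continuous : continuous critical_embedding.
Proof.
apply: continuous_to_sub.
suff : continuous (fun z : Z => (rolled_coamoeba (set_val z) : RP1_4 R,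
  projector (homog 1 (coords (set_val (set_val z)))))) by [].
move=> z; have [Vz z0] := set_valP (set_val z).
have cv : continuous (fun z : Z => set_val (set_val z)).
  by move=> y; apply: (@continuous_at_comp _ _ _ set_val set_val); exact: set_val_continuous.
have cz j : continuous_at z (fun z : Z => set_val (set_val z) 0 j).
  by apply: (@continuous_at_comp _ _ _ _ (fun M : 'rV_4 => M 0 j)); [exact: cv|exact: continuous_entry].
apply: continuous_at_pair.
  apply: continuous_at_ptws => j.
  have [cre cim] := Re_Im_continuous (set_val (set_val z) 0 j).
  apply: (@hcoord_continuous R _ (fun z : Z => complex.Re (set_val (set_val z) 0 j))
    (fun z : Z => complex.Im (set_val (set_val z) 0 j))).
  - exact: (@continuous_at_comp _ _ _ _ (fun z : Cplx R => complex.Re z) z (cz j) cre).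
  - exact: (@continuous_at_comp _ _ _ _ (fun z : Cplx R => complex.Im z) z (cz j) cim).
  - exact: complex_pair_neq0.
apply: projector_continuous_at; last exact: homog1_neq0.
apply: continuous_at_mx => i k; rewrite ord1.
have [l ->|->] := unliftP ord0 k.
  apply: (@continuous_at_ext R _ (fun z : Z => coords (set_val (set_val z)) 0 (l : 'I_(2 + 2)))).
    apply: (@continuous_at_comp _ _ _ (fun z : Z => coords (set_val (set_val z))) (fun M => M 0 (l : 'I_(2 + 2)))).
      by apply: (@continuous_at_comp _ _ _ _ coords); [exact: cv|exact: coords_continuous].
    exact: continuous_entry.
  by move=> y; rewrite [RHS]mxE liftK.
apply: (@continuous_at_ext R _ (fun=> 1)); first exact: continuous_at_cst.
by move=> y; rewrite homog0.
Qed.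

Lemma critical_embedding_is_embedding : embedding critical_embedding.
Proof.
split.
  move=> z z' e; apply: val_inj; apply: val_inj.
  by have := congr1 point_of e; rewrite !point_ofK !set_valE.
move=> A; split; last first.
  by move=> [U oU <-]; move/continuousP : critical_embedding_continuous; apply.
case=> _ [U oU <-] <-.
exists [set x : E | (set_val x).2 ord0 ord0 != 0 /\ U (point_of x)].
  rewrite openE => x [x0 Ux].
  have cE : continuous (fun x : E => (set_val x).2 ord0 ord0).
    by apply: projection_entry_continuous => y; exact: cvg_id.
  have oN : open [set t : R | t != 0].
    rewrite (_ : [set t | _] = ~` [set 0]); last by apply/seteqP; split=> t /= /eqP.
    apply: closed_openC; apply: accessible_closed_set1.
    exact: hausdorff_accessible (@Rhausdorff R).
  have n1 := cE x _ (open_nbhs_nbhs (conj oN x0)).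
  have n2 := point_of_continuous x0 (open_nbhs_nbhs (conj oU Ux)).
  exact: (@filterI _ (nbhs x) _ _ _ n1 n2).
apply/seteqP; split=> z /=; first by move=> [_]; rewrite point_ofK.
move=> Uz; split; last by rewrite point_ofK.
by rewrite /critical_embedding set_valE /= projector_diag ?homog1_neq0// homog0 oner_neq0.
Qed.

Lemma sec_injective : injective (@sec R X Y).
Proof.
have sep (i j c k d e : 'I_5) : uniq [:: ord0; c; k; d; e] ->
    (forall i, i \in [:: ord0; c; k; d; e]) -> @sec R X Y i = sec j ->
    (i \in [:: ord0; c] -> j \in [:: ord0; c]) /\
    (i \in [:: k; d] -> j \in [:: k; d]).
  move=> un all5 eij.
  have [b [h [h' [cb [h0 fh vh] [h'0 fh' vh']]]]] := separated_pencil gen un all5.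
  have eb := congr1 (fun s => s (sub_elt (cb : [set b | critical_direction X Y b] b))) eij.
  split=> [/vh|/vh'] v; [apply/vh|apply/vh'];
    by apply: (sec_eq_vanishing (generic_frame_fiber gen) eb) v.
move=> i j eij.
pose o1 := @Ordinal 5 1 isT; pose o2 := @Ordinal 5 2 isT.
pose o3 := @Ordinal 5 3 isT; pose o4 := @Ordinal 5 4 isT.
have all1 l : l \in [:: ord0; o1; o2; o3; o4].
  by case: l => [[|[|[|[|[|//]]]]] ?].
have all2 l : l \in [:: ord0; o2; o1; o3; o4].
  by case: l => [[|[|[|[|[|//]]]]] ?].
(* The pairings {0,1},{2,3} and {0,2},{1,3} of indices, with 4 left over *)
have [a1 a2] := sep i j o1 o2 o3 o4 isT all1 eij.
have [b1 b2] := sep i j o2 o1 o3 o4 isT all2 eij.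
have [c1 c2] := sep j i o1 o2 o3 o4 isT all1 (esym eij).
have [d1 d2] := sep j i o2 o1 o3 o4 isT all2 (esym eij).
apply: val_inj; move: a1 a2 b1 b2 c1 c2 d1 d2; clear.
case: i j => [[|[|[|[|[|//]]]]] ?] [[|[|[|[|[|//]]]]] ?] //=;
  rewrite !inE /= => a1 a2 b1 b2 c1 c2 d1 d2; 
  exfalso; auto.
Qed.

End Plane.

Theorem theorem2 (R : realType) :
  for_generic_plane (fun V : set 'rV[Cplx R]_4 =>
    exists (Zhat : topologicalType)
           (iota : set_type (@critical_points R V) -> Zhat)
           (pr : Zhat -> set_type (@critical_values R V)),
      [/\ compactification iota,
          circle_bundle R pr,
          (forall z, set_val (pr (iota z)) = rolled_coamoeba (set_val z)) &
          exists s : 'I_5 -> set_type (@critical_values R V) -> Zhat,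
            [/\ (forall j, cont_section pr (s j)),
                injective s &
                range iota = ~` \bigcup_(j in setT) range (s j)]]).
Proof.
exists (@nongeneric_plane R); split; first exact: nongeneric_plane_algebraic.
  exact: nongeneric_plane_proper.
move=> V [p [M fr]] nE.
have gen : generic_frame p M by apply: contrapT => ng; apply: nE; exists p, M.
have genf := generic_frame_fiber gen.
have X0 := re_forms0 p M; have Y0 := im_forms0 p M.
rewrite (critical_valuesE fr gen).
exists (set_type (bundle_space (re_forms p M) (im_forms p M))).
exists (critical_embedding fr), (@proj_base R (re_forms p M) (im_forms p M)); split.
- split; [exact: bundle_space_compact|exact: bundle_space_hausdorff|exact: critical_embedding_is_embedding|].
  by rewrite critical_embedding_range; exact: off_divisors_dense.
- exact: proj_base_circle_bundle.
- by move=> z; rewrite proj_base_val /critical_embedding set_valE.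
- exists (@sec R (re_forms p M) (im_forms p M)); split.
  + by move=> k; split; [exact: sec_continuous|exact: secK].
  + exact: sec_injective.
  + rewrite critical_embedding_range; apply/seteqP; split=> x.
      move=> nx [k _ [b _ e]]; apply: (nx k); rewrite -e; exact: sec_on_divisor.
    move=> nx k dx; apply: nx; exists k => //.
    by exists (proj_base x) => //; exact: sec_eq.
Qed.
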